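(* Let $t_0<t_1$, $0<\alpha\le 1$, $\beta>0$, $x_0,x_1,l_1\in\mathbb{R}$, and let $L_0,L_1$ be real functions of three real variables $(t,x,y)$. Consider the isoperimetric problem ($P_1$): extremize $$J_0(x(\cdot))=\int_{t_0}^{t_1}(t_1-t)^{\beta-1}L_0\big(t,x(t),({}^{c}D^{\alpha}_{t_0+}x)(t)\big)\,dt$$ over $x\in PC^{\alpha}([t_0,t_1],\mathbb{R})$ subject to $x(t_0)=x_0$, $x(t_1)=x_1$ and $$J_1(x(\cdot))=\int_{t_0}^{t_1}(t_1-t)^{\beta-1}L_1\big(t,x(t),({}^{c}D^{\alpha}_{t_0+}x)(t)\big)\,dt=l_1.$$ Suppose that $x^0$ delivers a weak local minimum in ($P_1$) and that $L_i,L_{ix},L_{iy}$, $i=0,1$, are continuous in some neighborhood of the graph $\{(t,x^0(t),({}^{c}D^{\alpha}_{t_0+}x^0)(t)):t\in[t_0,t_1]\}$. Let $T$ be the set of continuity points of ${}^{c}D^{\alpha}_{t_0+}x^0$ in $[t_0,t_1]$. Then there exist numbers $\mu_0,\mu_1$, not both zero, such that for $L=\mu_0L_0+\mu_1L_1$ and $b(t)=(t_1-t)^{\beta-1}L_x\big(t,x^0(t),({}^{c}D^{\alpha}_{t_0+}x^0)(t)\big)$ the following holds: 1) if $0<\alpha<\beta$, then for all $t\in T$ $$(t_1-t)^{1-\alpha}(I^{\alpha}_{t_1-}b)(t)+(t_1-t)^{\beta-\alpha}L_y\big(t,x^0(t),({}^{c}D^{\alpha}_{t_0+}x^0)(t)\big)=0;$$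 2) if $0<\beta\le\alpha\le1$, then for some constant $k$ and all $t\in T$ $$(t_1-t)^{1-\beta}(I^{\alpha}_{t_1-}b)(t)+L_y\big(t,x^0(t),({}^{c}D^{\alpha}_{t_0+}x^0)(t)\big)=\frac{k}{\Gamma(\alpha)}(t_1-t)^{\alpha-\beta}.$$
   Context: $PC([t_0,t_1],\mathbb{R})$ is the set of piecewise continuous functions: continuous on $[t_0,t_1]$ except at finitely many points of $(t_0,t_1)$, where they have discontinuities of the first kind (finite one-sided limits). For $\alpha>0$: $(I^{\alpha}_{t_0+}\varphi)(t)=\frac{1}{\Gamma(\alpha)}\int_{t_0}^{t}(t-\tau)^{\alpha-1}\varphi(\tau)\,d\tau$ and $(I^{\alpha}_{t_1-}\varphi)(t)=\frac{1}{\Gamma(\alpha)}\int_{t}^{t_1}(\tau-t)^{\alpha-1}\varphi(\tau)\,d\tau$. For $0<\alpha<1$ and continuous $\varphi$: $({}^{c}D^{\alpha}_{t_0+}\varphi)(t)=\frac{d}{dt}\big(I^{1-\alpha}_{t_0+}(\varphi(\cdot)-\varphi(t_0))\big)(t)$; for $\alpha=1$ it is the ordinary derivative. $PC^{\alpha}([t_0,t_1],\mathbb{R})$ is the set of all continuous $\varphi$ with $\varphi(t)=\varphi(t_0)+(I^{\alpha}_{t_0+}\psi)(t)$ on $[t_0,t_1]$ for some $\psi\in PC([t_0,t_1],\mathbb{R})$; then ${}^{c}D^{\alpha}_{t_0+}\varphi=\psi$ at the continuity points of $\psi$. Norm: $\|y\|_{PC^{\alpha}}=\|y\|_{C}+\|{}^{c}D^{\alpha}_{t_0+}y\|_{L^{\infty}}$.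 A function $x\in PC^{\alpha}([t_0,t_1],\mathbb{R})$ is admissible if $x(t_0)=x_0$, $x(t_1)=x_1$ and $J_1(x(\cdot))=l_1$. An admissible $x^0$ delivers a weak local minimum in ($P_1$) if there is $\delta>0$ such that $J_0(x(\cdot))\ge J_0(x^0(\cdot))$ for every admissible $x$ with $\|x-x^0\|_{PC^{\alpha}}<\delta$. At a discontinuity point $t$ of ${}^{c}D^{\alpha}_{t_0+}x^0$ the graph is understood to contain both points $(t,x^0(t),({}^{c}D^{\alpha}_{t_0+}x^0)(t\pm0))$. Subscripts $x,y$ denote partial derivatives. *)

(* Defs.v *)
(* MathComp-Analysis: Lebesgue integration over an abstract [R : realType]. *)
From HB Require Import structures.
From mathcomp Require Import all_boot all_order all_algebra.
From mathcomp Require Import all_classical all_reals all_analysis.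

Set Implicit Arguments.
Unset Strict Implicit.
Unset Printing Implicit Defensive.

Import Order.TTheory GRing.Theory Num.Theory.
Import numFieldNormedType.Exports.

Local Open Scope classical_set_scope.
Local Open Scope ring_scope.

Section FractionalCalculus.
Context {R : realType}.
Implicit Types (a t : R) (f x y psi : R -> R).

Local Notation mu := (@lebesgue_measure R).

Definition Gamma a : R :=
  Rintegral mu `]0, +oo[ (fun s => s `^ (a - 1) * expR (- s)).

Definition RL_left (t0 a : R) f t : R :=
  (Gamma a)^-1 * Rintegral mu `[t0, t] (fun s => (t - s) `^ (a - 1) * f s).

Definition RL_right (t1 a : R) f t : R :=
  (Gamma a)^-1 * Rintegral mu `[t, t1] (fun s => (s - t) `^ (a - 1) * f s).

Variables t0 t1 : R.

(* Derivative relative to [t0, t1]: two-sided inside, one-sided at t0 and t1;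
   where it does not exist, [lim] returns an unspecified real. *)
Definition derive_on f t : R :=
  lim ((fun s => (s - t)^-1 * (f s - f t)) @ within `[t0, t1] t^').

Definition caputo a f : R -> R :=
  derive_on (if a == 1 then f
             else RL_left t0 (1 - a) (fun s => f s - f t0)).

Definition cont_points f : set R :=
  [set t | t \in `[t0, t1] /\ f @ within `[t0, t1] (nbhs t) --> f t].

Definition PC psi : Prop :=
  [/\ finite_set (`[t0, t1] `\` cont_points psi),
      `[t0, t1] `\` cont_points psi `<=` `]t0, t1[
    & forall t, (`[t0, t1] `\` cont_points psi) t ->
        cvg (psi @ t^'-) /\ cvg (psi @ t^'+)].

Definition PCa a x : Prop :=
  {within `[t0, t1], continuous x} /\
  exists2 psi, PC psi &
    forall t, t \in `[t0, t1] -> x t = x t0 + RL_left t0 a psi t.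

(* The second term is the L^oo norm on [t0, t1]: the derivative is extended
   by zero outside the interval. *)
Definition PCa_norm a y : \bar R :=
  (ereal_sup [set (`|y t|)%:E | t in `[t0, t1]]
   + 'N[mu]_+oo[EFin \o (caputo a y \_ `[t0, t1])])%E.

Definition functional (a b : R) (L : R -> R -> R -> R) x : R :=
  Rintegral mu `[t0, t1]
    (fun t => (t1 - t) `^ (b - 1) * L t (x t) (caputo a x t)).

Definition admissible (a b : R) (L1 : R -> R -> R -> R) (x0 x1 l1 : R) x :=
  [/\ PCa a x, x t0 = x0, x t1 = x1 & functional a b L1 x = l1].

Definition weak_local_min (a b : R) (L0 L1 : R -> R -> R -> R)
    (x0 x1 l1 : R) (xhat : R -> R) : Prop :=
  admissible a b L1 x0 x1 l1 xhat /\
  exists2 delta : R, 0 < delta &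
    forall x, admissible a b L1 x0 x1 l1 x ->
      (PCa_norm a (x \- xhat)%R < delta%:E)%E ->
      functional a b L0 xhat <= functional a b L0 x.

(* At a discontinuity point of the derivative only its one-sided limits enter
   the graph, not the unspecified value of [caputo] there. *)
Definition ext_graph a x : set (R * R * R) :=
  [set (t, x t, caputo a x t) | t in cont_points (caputo a x)] `|`
  [set p | exists t v, [/\ p = (t, x t, v),
     (`[t0, t1] `\` cont_points (caputo a x)) t &
     caputo a x @ t^'- --> v \/ caputo a x @ t^'+ --> v]].

End FractionalCalculus.

Section PartialDerivatives.
Context {R : realType}.
Implicit Type L : R -> R -> R -> R.

Definition partial_x L (t x y : R) : R := derive1 (fun u => L t u y) x.
Definition partial_y L (t x y : R) : R := derive1 (fun u => L t x u) y.

Definition uncurry3 L (p : R * R * R) : R := L p.1.1 p.1.2 p.2.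

Definition C1xy_near L (G : set (R * R * R)) : Prop :=
  exists U : set (R * R * R), [/\ open U, G `<=` U &
    forall t x y, U (t, x, y) ->
      [/\ derivable (fun u => L t u y) x 1,
          derivable (fun u => L t x u) y 1,
          {for (t, x, y), continuous (uncurry3 L)},
          {for (t, x, y), continuous (uncurry3 (partial_x L))} &
          {for (t, x, y), continuous (uncurry3 (partial_y L))}]].

End PartialDerivatives.

(* Main.v *)
(* A variation is a pair (u, v) with u = I^alpha v and v piecewise continuous; then
   the Caputo derivative of x^0 + u is that of x^0 plus v.  Since L_0, L_1 are C^1
   near the graph, whose closure is compact, the functionals J_i are strictly
   differentiable at 0 on every two-parameter family of variations, with linear part
   dJ_i(u, v) = int (t1 - t)^(beta-1) (L_ix u + L_iy v) dt.  Two parameters suffice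
   for a Lagrange rule among the variations with u(t1) = 0, hence
   mu0 dJ_0 + mu1 dJ_1 is a multiple k of u(t1).

   For v the indicator of [c, t1], u(t) = (t - c)_+^alpha / Gamma(alpha + 1), this is
   an identity in c; minus its right derivative (by dominated convergence) is the
   Euler equation
     (I^alpha_{t1-} b)(c) + (t1 - c)^(beta-1) L_y = k / Gamma(alpha) (t1 - c)^(alpha-1)
   at every continuity point c < t1.  As c tends to t1 the first term of the
   identity is O((t1 - c)^(alpha+beta)) and the second is
   (L_y(t1) + o(1)) (t1 - c)^beta / beta if L_y is continuous at t1, and
   O((t1 - c)^beta) in any case: this gives k = 0 when alpha < beta, and the value of
   L_y at t1 when beta <= alpha. *)
Require Import Defs.
From HB Require Import structures.
From mathcomp Require Import all_boot all_order all_algebra.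
From mathcomp Require Import all_classical all_reals all_analysis.
From mathcomp Require Import measurable_realfun ring lra.
Import Order.TTheory GRing.Theory Num.Theory.
Import numFieldNormedType.Exports.
Local Open Scope classical_set_scope.
Local Open Scope ring_scope.
Set Implicit Arguments.
Unset Strict Implicit.
Unset Printing Implicit Defensive.

(** * Integrals of powers *)

Section powers.
Context {R : realType}.
Local Notation mu := (@lebesgue_measure R).
Implicit Types a b c d p q t x : R.

(** Three obstacles shape the proof. The Caputo derivative is a limit of difference quotients, so
    identifying it with v takes I^(1-alpha) I^alpha = I^1 for alpha < 1. By Fubini this rests on
    Gamma(alpha) Gamma(1-alpha) = B(alpha, 1-alpha); as [Gamma] is the real part of a possibly
    infinite integral, the same identity shows that it is finite and nonzero. At finitely many
    points the derivative has an unspecified value and L_i is controlled only at its one-sided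
    limits. Hence estimates are made at continuity points, with one radius for all of them, and
    integrals are compared off finite sets. The condition u(t1) = 0 is linear, so it is met exactly
    by subtracting a multiple of one fixed variation. One scalar nonlinear constraint remains, and
    the intermediate value theorem solves it; no implicit function theorem is called for. Taking
    indicators as test functions replaces fractional integration by parts and a du Bois-Reymond
    argument: the Euler equation comes out pointwise, at the continuity points themselves. *)

Lemma integrableDr (D : set R) (f g : R -> R) : measurable D ->
  mu.-integrable D (EFin \o f) -> mu.-integrable D (EFin \o g) ->
  mu.-integrable D (EFin \o (fun x => f x + g x)).
Proof. by move=> mD intf intg; exact: (@integrableD _ _ _ mu D mD (EFin \o f) (EFin \o g)). Qed.

Lemma integrableZlr (D : set R) c (f : R -> R) : measurable D ->
  mu.-integrable D (EFin \o f) ->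
  mu.-integrable D (EFin \o (fun x => c * f x)).
Proof. by move=> mD intf; exact: (@integrableZl _ _ _ mu D mD c (EFin \o f)). Qed.

Lemma integrableBr (D : set R) (f g : R -> R) : measurable D ->
  mu.-integrable D (EFin \o f) -> mu.-integrable D (EFin \o g) ->
  mu.-integrable D (EFin \o (fun x => f x - g x)).
Proof. by move=> mD intf intg; exact: (@integrableB _ _ _ mu D mD (EFin \o f) (EFin \o g)). Qed.

Lemma integrable_dominated (D : set R) (f g : R -> R) : measurable D ->
  measurable_fun D f -> (forall x, D x -> `|f x| <= g x) ->
  mu.-integrable D (EFin \o g) -> mu.-integrable D (EFin \o f).
Proof.
move=> mD mf fg; apply: le_integrable => //; first exact/measurable_EFinP.
by move=> x Dx /=; rewrite lee_fin (le_trans (fg x Dx))// ler_norm.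
Qed.

Lemma integrable_bounded (D : set R) (f : R -> R) (M : R) : measurable D ->
  (mu D < +oo)%E -> measurable_fun D f -> (forall x, D x -> `|f x| <= M) ->
  mu.-integrable D (EFin \o f).
Proof.
move=> mD muD mf fM; apply: measurable_bounded_integrable => //.
exists M; split; first exact: num_real.
by move=> y My x Dx; rewrite /= (le_trans (fM x Dx))// ltW.
Qed.

(** The pushforward under the affine map, scaled by |c|, is a measure with the right value on every
    interval []x, y]], so it is Lebesgue measure by uniqueness. *)
Lemma lebesgue_measure_affine c d (A : set R) : c != 0 -> measurable A ->
  mu A = (`|c|%:E * mu ((fun x => c * x + d)%R @^-1` A))%E.
Proof.
move=> c0 mA.
have maff : measurable_fun [set: measurableTypeR R]
    ((fun x => c * x + d)%R : measurableTypeR R -> measurableTypeR R).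
  by apply: measurable_funD => //; exact: measurable_funM.
pose phi : measurableTypeR R -> measurableTypeR R := fun x => (c * x + d)%R.
pose nu := mscale (NngNum (normr_ge0 c)) (pushforward mu phi).
rewrite (lebesgue_measure_unique (mu := nu maff))//= => _ [[x y] /= xy <-].
rewrite /nu /mscale /= /pushforward /=.
rewrite lebesgue_measure_itv/=.
have [c_gt0|c_lt0|c_eq0] := ltgtP 0 c; last by rewrite -c_eq0 eqxx in c0.
- rewrite (_ : _ @^-1` _ = `](x - d) / c, (y - d) / c]%classic); last first.
    apply/seteqP; split => z /=; rewrite /phi !in_itv/= ltr_pdivrMr// ler_pdivlMr//;
    by move=> /andP[? ?]; apply/andP; split; lra.
  rewrite lebesgue_measure_itv/= !lte_fin ltr_pM2r ?invr_gt0//.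
  rewrite ltrD2r; case: ifPn => //; rewrite ?mule0// => _.
  by rewrite gtr0_norm// -EFinM; congr EFin; field.
(* A negative slope reverses the interval, so the closed end of the preimage is the left one. *)
- rewrite (_ : _ @^-1` _ = `[(y - d) / c, (x - d) / c[%classic); last first.
    apply/seteqP; split => z /=; rewrite /phi !in_itv/= ltr_ndivlMr// ler_ndivrMr//;
    by move=> /andP[? ?]; apply/andP; split; lra.
  rewrite lebesgue_measure_itv/= !lte_fin ltr_nM2r ?invr_lt0//.
  rewrite ltrD2r; case: ifPn => //; rewrite ?mule0// => _.
  by rewrite ltr0_norm// -EFinM; congr EFin; field.
Qed.

(** Stated in the extended reals for nonnegative functions, so that it applies to the Gamma
    integrals before they are known to be finite. *)
Lemma ge0_integral_affine c d (f : R -> \bar R) : c != 0 ->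
  measurable_fun [set: R] f -> (forall x, 0 <= f x)%E ->
  (\int[mu]_x f x = `|c|%:E * \int[mu]_x f (c * x + d)%R)%E.
Proof.
move=> c0 mf f0.
have maff : measurable_fun [set: measurableTypeR R]
    ((fun x => c * x + d)%R : measurableTypeR R -> measurableTypeR R).
  by apply: measurable_funD => //; exact: measurable_funM.
pose phi : measurableTypeR R -> measurableTypeR R := fun x => (c * x + d)%R.
pose nu := mscale (NngNum (normr_ge0 c)) (pushforward mu phi).
rewrite (eq_measure_integral (nu maff)); last first.
  by move=> A mA _; exact: lebesgue_measure_affine.
by rewrite ge0_integral_mscale// ge0_integral_pushforward.
Qed.

Lemma derive_powR_shift a p t : a < t ->
  is_derive t 1 (fun s => (s - a) `^ p) (p * (t - a) `^ (p - 1)).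
Proof.
move=> at_; have ta0 : 0 < t - a by rewrite subr_gt0.
rewrite -[X in is_derive _ _ _ X]mulr1.
apply: (@is_derive1_comp _ (fun u => u `^ p) (fun s => s - a)).
  exact: is_derive1_powR.
exact: is_derive_shift.
Qed.

Lemma continuous_powR_shift a p t : a < t ->
  {for t, continuous (fun s => (s - a) `^ p)}.
Proof.
move=> at_; apply/differentiable_continuous/derivable1_diffP.
by apply: ex_derive; exact: derive_powR_shift.
Qed.

(** For p < 1 the integrand is unbounded near a. The fundamental theorem of calculus is used on
    [[a + e n, b]], and monotone convergence lets [e n] tend to 0. *)
Lemma integral_powR_subl a b p : a <= b -> 0 < p ->
  (\int[mu]_(s in `[a, b]) ((s - a) `^ (p - 1))%:E = ((b - a) `^ p / p)%:E)%E.
Proof.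
rewrite le_eqVlt => /predU1P[->|ab] p0.
  by rewrite set_itv1 integral_set1 subrr powR0 ?gt_eqF// mul0r.
have ba0 : 0 < b - a by rewrite subr_gt0.
(* The denominator starts at 2, so that [a + e n < b] already holds for n = 0. *)
pose e n : R := (b - a) / n.+2%:R.
have e0 n : 0 < e n by rewrite divr_gt0.
have eb n : a + e n < b.
  by rewrite -ltrBrDl /e ltr_pdivrMr// ltr_pMr// ltr1n.
have e_cvg : e @ \oo --> 0.
  rewrite -(mulr0 (b - a)); apply: cvgMr.
  have := @cvg_harmonic R; rewrite -(cvg_shiftS _) /=.
  exact.
pose F n := `[a + e n, b]%classic.
pose G t := (t - a) `^ p / p.
have intF n : (\int[mu]_(s in F n) ((s - a) `^ (p - 1))%:E =
    (G b - G (a + e n))%:E)%E.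
  have gta x : a + e n <= x -> a < x by apply: lt_le_trans; rewrite ltrDl.
  have dG x : a < x -> is_derive x 1 G ((x - a) `^ (p - 1)).
    move=> ax; have dp := derive_powR_shift p ax.
    have -> : (x - a) `^ (p - 1) = p * (x - a) `^ (p - 1) / p by field; lra.
    have -> : G = (fun s => p^-1 *: (s - a) `^ p).
      by apply/funext => s; rewrite /G mulrC.
    rewrite mulrC; exact: is_deriveZ.
  have cG x : a < x -> {for x, continuous G}.
    move=> /dG ?; apply/differentiable_continuous/derivable1_diffP.
    exact: ex_derive.
  rewrite (@continuous_FTC2 _ _ G)//.
  - apply: continuous_in_subspaceT => x.
    rewrite inE/= in_itv/= => /andP[/gta ? _]; exact: continuous_powR_shift.
  - split.
    + move=> x; rewrite in_itv/= => /andP[/ltW/gta/dG ? _]; exact: ex_derive.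
    + by apply/cvg_at_right_filter/cG/gta.
    + by apply/cvg_at_left_filter/cG/gta/ltW.
  - move=> x; rewrite in_itv/= => /andP[/ltW/gta/dG ? _].
    by rewrite derive1E derive_val.
have ndF : nondecreasing_seq F.
  apply/nondecreasing_seqP => n; apply/subsetPset/subset_itvr.
  by rewrite bnd_simp lerD2l /e ler_pM2l// lef_pV2 ?posrE// ler_nat.
have UF : \bigcup_n F n = `]a, b]%classic.
  apply/seteqP; split => [x [n _]|x] /=; rewrite !in_itv/=.
    rewrite /F/= in_itv/= => /andP[h ->].
    by rewrite andbT (lt_le_trans _ h)// ltrDl.
  move=> /andP[ax xb]; have xa0 : 0 < x - a by rewrite subr_gt0.
  have /cvgrPdist_lt/(_ _ xa0) [n _ /(_ n (leqnn n))] := e_cvg.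
  rewrite /= sub0r normrN gtr0_norm// => enx; exists n => //=.
  by rewrite /F/= in_itv/= xb andbT -lerBrDl ltW.
have mf : measurable_fun setT (fun s : R => (s - a) `^ (p - 1)).
  apply: (@measurableT_comp _ _ _ _ _ _ (@powR R ^~ (p - 1))).
    exact: measurable_powR.
  exact: measurable_funB.
(* The sets [F n] exhaust only []a, b]]; the point a is negligible. *)
rewrite -integral_itv_obnd_cbnd//; last first.
  by apply/measurable_EFinP; exact: measurable_funTS.
rewrite -UF.
have cvgI : (\int[mu]_(s in F i) ((s - a) `^ (p - 1))%:E @[i --> \oo] -->
    \int[mu]_(s in \bigcup_i F i) ((s - a) `^ (p - 1))%:E)%E.
  apply: ge0_nondecreasing_set_cvg_integral => //.
  - by move=> i; exact: measurable_itv.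
  - by move=> i; apply/measurable_EFinP; exact: measurable_funTS.
  - by move=> i x _; rewrite lee_fin powR_ge0.
rewrite (funext intF) in cvgI; apply: (cvg_unique _ cvgI) => //.
apply: cvg_EFin; first exact: nearW.
rewrite -[X in _ --> X]subr0; apply: cvgB; first exact: cvg_cst.
rewrite -(mul0r p^-1); apply: cvgMl.
rewrite (_ : (fun n => _) = fun n => e n `^ p); last first.
  by apply/funext => n; rewrite addrAC subrr add0r.
by have /cvg_at_rightP := powR_cvg0 p0; apply.
Qed.

(** The reflection s -> a + b - s exchanges the two endpoints. *)
Lemma integral_powR_subr a b p : a <= b -> 0 < p ->
  (\int[mu]_(s in `[a, b]) ((b - s) `^ (p - 1))%:E = ((b - a) `^ p / p)%:E)%E.
Proof.
move=> ab p0; rewrite -(integral_powR_subl ab p0).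
have mf (g : R -> R) : measurable_fun setT g ->
    measurable_fun setT (fun s => ((g s) `^ (p - 1))%:E).
  move=> mg; apply/measurable_EFinP.
  apply: (@measurableT_comp _ _ _ _ _ _ (@powR R ^~ (p - 1))) => //.
rewrite integral_mkcond [RHS]integral_mkcond.
rewrite (@ge0_integral_affine (-1) (a + b)) ?oppr_eq0//; last 2 first.
  apply/(measurable_restrictT _ _).1 => //.
  by apply: measurable_funTS; apply: mf; exact: measurable_funB.
  by move=> x; rewrite patchE; case: ifPn => // _; rewrite lee_fin powR_ge0.
rewrite normrN1 mul1e; apply: eq_integral => x _; rewrite !patchE.
have -> : (-1 * x + (a + b) \in `[a, b]%classic) = (x \in `[a, b]%classic).
  by apply/idP/idP; rewrite !inE/= !in_itv/= => /andP[? ?]; apply/andP; split; lra.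
by case: ifPn => // _; congr (_ `^ _)%:E; ring.
Qed.

Lemma measurable_powR_subl a p (D : set R) :
  measurable_fun D (fun s => (s - a) `^ p).
Proof.
apply: measurable_funTS.
apply: (@measurableT_comp _ _ _ _ _ _ (@powR R ^~ p)) => //.
exact: measurable_funB.
Qed.

Lemma measurable_powR_subr b p (D : set R) :
  measurable_fun D (fun s => (b - s) `^ p).
Proof.
apply: measurable_funTS.
apply: (@measurableT_comp _ _ _ _ _ _ (@powR R ^~ p)) => //.
exact: measurable_funB.
Qed.

Lemma ge0_integrable (D : set R) (f : R -> R) (r : R) : measurable D ->
  measurable_fun D f -> (forall x, D x -> 0 <= f x) ->
  (\int[mu]_(x in D) (f x)%:E = r%:E)%E -> mu.-integrable D (EFin \o f).
Proof.
move=> mD mf f0 fr; apply/integrableP; split; first exact/measurable_EFinP.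
under eq_integral => x /set_mem Dx do rewrite /= ger0_norm ?f0//.
by rewrite fr ltry.
Qed.

Lemma integrable_powR_subl a b p : a <= b -> 0 < p ->
  mu.-integrable `[a, b] (EFin \o (fun s => (s - a) `^ (p - 1))).
Proof.
move=> ab p0; apply: (ge0_integrable _ _ _ (integral_powR_subl ab p0)) => //.
- exact: measurable_powR_subl.
- by move=> x _; exact: powR_ge0.
Qed.

Lemma integrable_powR_subr a b p : a <= b -> 0 < p ->
  mu.-integrable `[a, b] (EFin \o (fun s => (b - s) `^ (p - 1))).
Proof.
move=> ab p0; apply: (ge0_integrable _ _ _ (integral_powR_subr ab p0)) => //.
- exact: measurable_powR_subr.
- by move=> x _; exact: powR_ge0.
Qed.

(** A power is monotone on positive reals, so one of the two endpoint values is a bound; their sum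
    serves for either sign of the exponent. *)
Lemma powR_le_sum (m M x e : R) : 0 < m -> m <= x <= M ->
  x `^ e <= m `^ e + M `^ e.
Proof.
move=> m0 /andP[mx xM]; have x0 : 0 < x by exact: lt_le_trans mx.
have M0 : 0 < M by exact: lt_le_trans xM.
have [e0|e0] := leP 0 e.
  apply: (@le_trans _ _ (M `^ e)); last by rewrite lerDr powR_ge0.
  by apply: ge0_ler_powR; rewrite // nnegrE ltW.
rewrite -(opprK e) (powRN x) (powRN m).
apply: (@le_trans _ _ (m `^ (- e))^-1); last by rewrite lerDl powR_ge0.
rewrite lef_pV2 ?posrE ?powR_gt0//.
by apply: ge0_ler_powR; rewrite // ?nnegrE ?oppr_ge0 ltW.
Qed.

(** On each half of the interval only one factor can be singular; the other one lies between fixed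
    bounds, which gives [K1] and [K2]. *)
Lemma integrable_powR_subl_subr a b p q : a < b -> 0 < p -> 0 < q ->
  mu.-integrable `[a, b]
    (EFin \o (fun s => (s - a) `^ (p - 1) * (b - s) `^ (q - 1))).
Proof.
move=> ab p0 q0; pose c := b - a; have c0 : 0 < c by rewrite subr_gt0.
pose K1 := (c / 2) `^ (p - 1) + c `^ (p - 1).
pose K2 := (c / 2) `^ (q - 1) + c `^ (q - 1).
have K10 : 0 <= K1 by rewrite addr_ge0// powR_ge0.
have K20 : 0 <= K2 by rewrite addr_ge0// powR_ge0.
apply: (@integrable_dominated _ _ (fun s => K2 * (s - a) `^ (p - 1)
    + K1 * (b - s) `^ (q - 1))) => //.
- apply: measurable_funM; first exact: measurable_powR_subl.
  exact: measurable_powR_subr.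
- move=> s /=; rewrite in_itv/= => /andP[as_ sb].
  rewrite ger0_norm ?mulr_ge0 ?powR_ge0//.
  have [h|h] := leP (c / 2) (s - a).
    apply: (@le_trans _ _ (K1 * (b - s) `^ (q - 1))).
      apply/ler_wpM2r/powR_le_sum; rewrite ?powR_ge0 ?divr_gt0//.
      by rewrite h /c; lra.
    by rewrite lerDr mulr_ge0// powR_ge0.
  apply: (@le_trans _ _ (K2 * (s - a) `^ (p - 1))).
    rewrite mulrC; apply/ler_wpM2r/powR_le_sum; rewrite ?powR_ge0 ?divr_gt0//.
    by apply/andP; split; move: h; rewrite /c; lra.
  by rewrite lerDl mulr_ge0// powR_ge0.
- apply: integrableDr => //; apply: integrableZlr => //.
    exact: integrable_powR_subl (ltW ab) p0.
  exact: integrable_powR_subr (ltW ab) q0.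
Qed.
End powers.

(** * The product Gamma(a) Gamma(1 - a) *)

Section gamma.
Context {R : realType}.
Local Notation mu := (@lebesgue_measure R).
Implicit Types a b c d p q t x : R.

(* Euler's [B(a, 1 - a)]. *)
Definition betaC a : R := \int[mu]_(s in `[0, 1]) (s `^ (a - 1) * (1 - s) `^ (- a)).

Lemma integrable_beta a : 0 < a < 1 ->
  mu.-integrable `[0, 1] (EFin \o (fun s => s `^ (a - 1) * (1 - s) `^ (- a))).
Proof.
move=> /andP[a0 a1]; have b0 : 0 < 1 - a by rewrite subr_gt0.
have := @integrable_powR_subl_subr R 0 1 a (1 - a) ltr01 a0 b0.
rewrite (_ : 1 - a - 1 = - a); last by ring.
by under [X in _ -> mu.-integrable _ (_ \o X)]eq_fun do rewrite -[X in X `^ (a - 1)]subr0.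
Qed.

Lemma integral_betaE a : 0 < a < 1 ->
  (\int[mu]_(s in `[0%R, 1%R]) (s `^ (a - 1) * (1 - s) `^ (- a))%:E = (betaC a)%:E)%E.
Proof.
by move=> a01; rewrite /betaC /Rintegral fineK//; exact: integrable_fin_num (integrable_beta a01).
Qed.

(** Both exponents are nonpositive, so both factors are at least 1 on []0, 1[], and the integral is
    at least 1. *)
Lemma beta_gt0 a : 0 < a < 1 -> 0 < betaC a.
Proof.
move=> /[dup] a01 /andP[a0 a1].
have intb := integrable_beta a01.
have Soo : (`]0, 1[ : set R) `<=` `[0, 1] by exact: subset_itvW.
have -> : betaC a = \int[mu]_(s in `]0, 1[) (s `^ (a - 1) * (1 - s) `^ (- a)).
  rewrite /betaC /Rintegral -(integral_itv_bndoo true false)//.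
  apply/measurable_EFinP/measurable_funM; last exact: measurable_powR_subr.
  by apply: measurable_funTS; exact: measurable_powR.
apply: (@lt_le_trans _ _ 1) => //.
have int1 : \int[mu]_(s in `]0, 1[) (cst 1 s) = 1 :> R.
  rewrite Rintegral_cst//= lebesgue_measure_itv/= lte_fin ltr01 oppr0 adde0 /=.
  by rewrite mulr1.
rewrite -[X in X <= _]int1; apply: le_Rintegral => //.
- apply: (@integrable_bounded _ _ _ 1) => //; last first.
    by move=> x _; rewrite /= normr1.
  by rewrite lebesgue_measure_itv/= lte_fin ltr01 oppr0 adde0 ltry.
- by apply: integrableS intb.
- move=> s /=; rewrite in_itv/= => /andP[s0 s1].
  rewrite -[X in X <= _]mulr1; apply: ler_pM => //.
    rewrite -[X in X <= _](powRr0 s); apply: ger_powR; first by rewrite s0 ltW.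
    by rewrite subr_le0 ltW.
  rewrite -[X in X <= _](powRr0 (1 - s)); apply: ger_powR.
    by rewrite subr_gt0 s1 lerBlDr lerDl ltW.
  by rewrite oppr_le0 ltW.
Qed.

(** The exponents add up to -1, so under s = (t - b) x + b the powers of t - b cancel the Jacobian
    and the value does not depend on the interval. This is why I^(1-a) I^a has a constant kernel. *)
Lemma integral_beta_kernel a b t : 0 < a < 1 -> b < t ->
  (\int[mu]_(s in `[b, t]) ((t - s) `^ (- a) * (s - b) `^ (a - 1))%:E =
   (betaC a)%:E)%E.
Proof.
move=> /[dup] a01 /andP[a0 a1] bt; rewrite -(integral_betaE a01).
have tb0 : 0 < t - b by rewrite subr_gt0.
rewrite integral_mkcond [RHS]integral_mkcond.
rewrite (@ge0_integral_affine _ (t - b) b) ?gt_eqF//; last 2 first.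
  apply/(measurable_restrictT _ _).1 => //.
  apply/measurable_EFinP/measurable_funM; first exact: measurable_powR_subr.
  exact: measurable_powR_subl.
  by move=> x; rewrite patchE; case: ifPn => // _; rewrite lee_fin mulr_ge0// powR_ge0.
rewrite gtr0_norm//.
rewrite -ge0_integralZl//; last 3 first.
- apply: measurableT_comp; last first.
    apply/measurable_funD => //; exact: measurable_funM.
  apply/(measurable_restrictT _ _).1 => //.
  apply/measurable_EFinP/measurable_funM; first exact: measurable_powR_subr.
  exact: measurable_powR_subl.
- by move=> x _; rewrite patchE; case: ifPn => // _; rewrite lee_fin mulr_ge0// powR_ge0.
- by rewrite lee_fin ltW.
have key x : 0 <= x -> x <= 1 ->
    (t - b) * ((t - ((t - b) * x + b)) `^ (- a) * ((t - b) * x) `^ (a - 1)) =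
    x `^ (a - 1) * (1 - x) `^ (- a).
  move=> x0 x1; have -> : t - ((t - b) * x + b) = (t - b) * (1 - x) by ring.
  rewrite !powRM ?subr_ge0// ?(ltW bt)//.
  have e : (t - b) `^ (- a) * (t - b) `^ (a - 1) = (t - b)^-1.
    rewrite -powRD; last by apply/implyP => _; rewrite gt_eqF.
    by rewrite addrA addNr add0r powR_inv1// ltW.
  transitivity ((t - b) * ((t - b) `^ (- a) * (t - b) `^ (a - 1)) *
    (x `^ (a - 1) * (1 - x) `^ (- a))); first by ring.
  by rewrite e divff ?gt_eqF// mul1r.
apply: eq_integral => x _; rewrite !patchE.
have -> : ((t - b) * x + b \in `[b, t]%classic) = (x \in `[0, 1]%classic).
  apply/idP/idP; rewrite !inE/= !in_itv/= => /andP[h1 h2].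
    by apply/andP; split; [move: h1|move: h2]; nra.
  by apply/andP; split; nra.
case: ifPn; last by rewrite mule0.
rewrite inE/= in_itv/= => /andP[x0 x1].
rewrite addrK -EFinM key//.
Qed.

Lemma integral_expRN :
  (\int[mu]_(s in `]0%R, +oo[) (expR (- s))%:E = 1)%E.
Proof.
have me : measurable_fun [set: R] (fun s : R => (expR (- s))%:E).
  by apply/measurable_EFinP/measurableT_comp => //; exact: measurable_expR.
rewrite integral_itv_obnd_cbnd; last exact: measurable_funTS.
rewrite -(integral_exponential_pdf (@ltr01 R)) integral_mkcond.
apply: eq_integral => x _; rewrite /exponential_pdf !patchE.
by case: ifPn => // _; rewrite mul1r mulN1r.
Qed.

(** The Gamma integrand extended by zero, which turns a product of two Gamma integrals into the
    integral of a convolution on the whole line. *)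
Definition gammaI a (x : R) : R := if 0 < x then x `^ (a - 1) * expR (- x) else 0.

Lemma measurable_gammaI a : measurable_fun [set: R] (gammaI a).
Proof.
apply: measurable_fun_ifT => //; first exact: measurable_fun_ltr.
apply: measurable_funM; first exact: measurable_powR.
by apply: measurableT_comp => //; exact: measurable_expR.
Qed.

Lemma gammaI_ge0 a x : 0 <= gammaI a x.
Proof. by rewrite /gammaI; case: ifPn => // _; rewrite mulr_ge0 ?powR_ge0 ?expR_ge0. Qed.

Lemma integral_gammaI a :
  (\int[mu]_(s in `]0%R, +oo[) (s `^ (a - 1) * expR (- s))%:E =
   \int[mu]_s (gammaI a s)%:E)%E.
Proof.
rewrite integral_mkcond; apply: eq_integral => x _.
by rewrite patchE /gammaI mem_setE in_itv/= andbT; case: ifPn.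
Qed.

(** The exponentials combine to exp(-u), free of x; what depends on x is the Beta kernel on []0,
    u[]. *)
Lemma gammaI_convolution a x u : 0 < a < 1 ->
  gammaI a x * gammaI (1 - a) (u - x) =
  if 0 < x < u then expR (- u) * ((u - x) `^ (- a) * x `^ (a - 1)) else 0.
Proof.
move=> a01; rewrite /gammaI subr_gt0.
case: (ltP 0 x) => x0 /=; last by rewrite mul0r.
case: (ltP x u) => xu /=; last by rewrite mulr0.
rewrite (_ : 1 - a - 1 = - a); last by ring.
rewrite (_ : - u = - x + - (u - x)); last by ring.
by rewrite expRD; ring.
Qed.

(** Translating the second integral by x and exchanging the integrals by Tonelli leaves the integral
    over u of the convolution at u, which is exp(-u) times the constant of
    [integral_beta_kernel]. *)
Lemma integral_gammaI_mul a : 0 < a < 1 ->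
  (\int[mu]_s (gammaI a s)%:E * \int[mu]_s (gammaI (1 - a) s)%:E = (betaC a)%:E)%E.
Proof.
move=> a01; have mg b := measurable_gammaI b.
have mgE b : measurable_fun [set: R] (fun x => (gammaI b x)%:E).
  exact/measurable_EFinP.
have g0 b x : (0 <= (gammaI b x)%:E)%E by rewrite lee_fin gammaI_ge0.
pose f (z : R * R) := (gammaI a z.1 * gammaI (1 - a) (z.2 - z.1))%:E.
have mf : measurable_fun [set: R * R] f.
  apply/measurable_EFinP/measurable_funM; first exact: measurableT_comp.
  by apply: measurableT_comp => //; exact: measurable_funB.
have f0 z : (0 <= f z)%E by rewrite lee_fin mulr_ge0// gammaI_ge0.
transitivity (\int[mu]_x \int[mu]_u f (x, u))%E.
  rewrite -ge0_integralZr//; last 2 first.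
  - exact: mgE.
  - by apply: integral_ge0 => x _; exact: g0.
  apply: eq_integral => x _.
  rewrite (@ge0_integral_affine _ 1 (- x))// normr1 mul1e.
  have mgx : measurable_fun [set: R] (fun u => (gammaI (1 - a) (1 * u - x))%:E).
    apply: (@measurableT_comp _ _ _ _ _ _ (fun y => (gammaI (1 - a) y)%:E)) => //.
    by apply: measurable_funD => //; exact: measurable_funM.
  have := @ge0_integralZl_EFin _ _ _ mu _ measurableT _ _ mgx _ (gammaI_ge0 a x).
  move=> /(_ (fun=> fun=> g0 _ _)) <-.
  by apply: eq_integral => u _; rewrite /f /= mul1r EFinM.
rewrite fubini_tonelli//.
transitivity (\int[mu]_(u in `]0%R, +oo[) ((expR (- u))%:E * (betaC a)%:E))%E.
  rewrite [RHS]integral_mkcond; apply: eq_integral => u _.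
  rewrite patchE mem_setE in_itv/= andbT.
  under eq_integral do rewrite /f/= gammaI_convolution//.
  case: (ltP 0 u) => u0; last first.
    apply: integral0_eq => x _; case: ifPn => // /andP[x0 xu].
    by have := lt_le_trans (lt_trans x0 xu) u0; rewrite ltxx.
  have mk : measurable_fun [set: R]
      (fun x => ((u - x) `^ (- a) * (x - 0) `^ (a - 1))%:E).
    apply/measurable_EFinP/measurable_funM; first exact: measurable_powR_subr.
    exact: measurable_powR_subl.
  rewrite -(integral_beta_kernel a01 u0) -[RHS]ge0_integralZl//; last 2 first.
  - exact: measurable_funTS.
  - by move=> x _; rewrite lee_fin mulr_ge0// powR_ge0.
  rewrite integral_itv_bndoo; last first.
    by apply: emeasurable_funM => //; exact: measurable_funTS.
  rewrite [RHS]integral_mkcond; apply: eq_integral => x _.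
  by rewrite patchE mem_setE in_itv/= subr0 -EFinM; case: ifPn.
have me : measurable_fun [set: R] (fun s : R => (expR (- s))%:E).
  by apply/measurable_EFinP/measurableT_comp => //; exact: measurable_expR.
rewrite ge0_integralZr//; last 2 first.
- exact: measurable_funTS.
- by rewrite lee_fin ltW// beta_gt0.
by rewrite integral_expRN mul1e.
Qed.

Lemma Gamma_ge0 a : 0 <= Gamma a.
Proof.
by apply: Rintegral_ge0 => x _; rewrite mulr_ge0 ?powR_ge0 ?expR_ge0.
Qed.

(** Passing from extended to real values requires both factors to be finite. They are: two
    nonnegative extended reals, one of them infinite, have product 0 or infinity, whereas the Beta
    value is a positive real. *)
Lemma Gamma_mul a : 0 < a < 1 -> Gamma a * Gamma (1 - a) = betaC a.
Proof.
move=> a01; have := integral_gammaI_mul a01; have := beta_gt0 a01.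
rewrite /Gamma /Rintegral !integral_gammaI.
have g0 b : (0 <= \int[mu]_s (gammaI b s)%:E)%E.
  by apply: integral_ge0 => x _; rewrite lee_fin gammaI_ge0.
move: (g0 a) (g0 (1 - a)).
move: (\int[mu]_s (gammaI a s)%:E)%E (\int[mu]_s (gammaI (1 - a) s)%:E)%E.
case=> [r| |]//; case=> [s| |]//=; rewrite ?lee_fin.
- by move=> _ _ _ [].
- rewrite le_eqVlt => /predU1P[<- _ b0|r0 _ _].
    by rewrite mul0e => -[e]; rewrite -e ltxx in b0.
  by rewrite gt0_muley.
- move=> _; rewrite le_eqVlt => /predU1P[<- b0|r0 _].
    by rewrite mule0 => -[e]; rewrite -e ltxx in b0.
  by rewrite gt0_mulye.
Qed.

Lemma Gamma1 : Gamma 1 = 1 :> R.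
Proof.
rewrite /Gamma /Rintegral; under eq_integral do rewrite subrr powRr0 mul1r.
by rewrite integral_expRN.
Qed.

(** For a < 1 the product with [Gamma (1 - a)] is the positive Beta value, so neither factor can be
    zero. *)
Lemma Gamma_gt0 a : 0 < a <= 1 -> 0 < Gamma a.
Proof.
move=> /andP[a0]; rewrite le_eqVlt => /predU1P[->|a1]; first by rewrite Gamma1.
have a01 : 0 < a < 1 by rewrite a0.
rewrite lt_neqAle Gamma_ge0 andbT; apply/eqP => g0.
by have := beta_gt0 a01; rewrite -Gamma_mul// -g0 mul0r ltxx.
Qed.
End gamma.

(** * Piecewise continuous functions *)

Section piecewise_continuous.
Context {R : realType}.
Local Notation mu := (@lebesgue_measure R).
Implicit Types (A : set R) (a b c d t s v : R) (f g : R -> R).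

Lemma near_nbhsP t (P : R -> Prop) : (\forall s \near t, P s) <->
  exists2 d : R, 0 < d & forall s, `|s - t| < d -> P s.
Proof.
split=> [/nbhs_ballP[d /= d0 h]|[d d0 h]].
  by exists d => // s st; apply: h; rewrite /ball/= distrC.
by apply/nbhs_ballP; exists d => //= s; rewrite /ball/= distrC; exact: h.
Qed.

Lemma cvg_withinP A t f l : f @ within A (nbhs t) --> l <->
  forall e : R, 0 < e -> exists2 d : R, 0 < d &
    forall s, `|s - t| < d -> A s -> `|l - f s| < e.
Proof.
split=> [/cvgrPdist_lt h e e0|h].
  by have := h e e0; rewrite near_withinE => /near_nbhsP.
apply/cvgrPdist_lt => e /h h'; rewrite near_withinE; exact/near_nbhsP.
Qed.

Lemma finite_set_nbhs A t : finite_set A ->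
  \forall s \near t, A s -> s = t.
Proof.
move=> finA; have : nbhs t (~` (A `\ t)).
  apply: open_nbhs_nbhs; split; last by case=> _; apply.
  apply: closed_openC.
  have /accessible_finite_set_closed := hausdorff_accessible (@Rhausdorff R).
  by apply; apply: sub_finite_set finA; exact: subDsetl.
apply: filterS => s h As; apply: contrapT => st; exact: h.
Qed.

Lemma finite_set_measurable A : finite_set A -> measurable A.
Proof. by move=> finA; apply: countable_measurable => //; exact: finite_set_countable. Qed.

Lemma finite_set_lebesgue0 A : finite_set A -> mu A = 0.
Proof. by move=> finA; apply: countable_lebesgue_measure0; exact: finite_set_countable. Qed.

(** This lemma and the next two discard the finitely many points at which a derivative takes an
    unspecified value. *)
Lemma measurable_fun_finite (D A : set R) f g : measurable D -> finite_set A ->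
  measurable_fun (D `\` A) g -> (forall s, D s -> ~ A s -> f s = g s) ->
  measurable_fun D f.
Proof.
move=> mD finA mg fg; have mA := finite_set_measurable finA.
rewrite -(setUIDK D A); apply/measurable_funU.
- exact: measurableI.
- exact: measurableD.
split; last first.
  apply: eq_measurable_fun mg => s; rewrite inE => -[Ds As].
  by rewrite fg.
move=> mDA B mB; apply: finite_set_measurable.
by apply: sub_finite_set finA => s [[]].
Qed.

Lemma Rintegral_finite (D A : set R) f g : measurable D -> finite_set A ->
  measurable_fun D g -> (forall s, D s -> ~ A s -> f s = g s) ->
  \int[mu]_(s in D) f s = \int[mu]_(s in D) g s.
Proof.
move=> mD finA mg fg; congr fine; apply: ae_eq_integral => //.
- apply/measurable_EFinP; apply: measurable_fun_finite finA _ fg => //.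
  by apply: measurable_funS mg => //; exact: subDsetl.
- exact/measurable_EFinP.
exists A; split; [exact: finite_set_measurable|exact: finite_set_lebesgue0|].
move=> s /= h; apply: contrapT => As; apply: h => Ds /=.
by rewrite fg.
Qed.

Lemma integrable_finite (D A : set R) f g : measurable D -> finite_set A ->
  (forall s, D s -> ~ A s -> f s = g s) ->
  mu.-integrable D (EFin \o g) -> mu.-integrable D (EFin \o f).
Proof.
move=> mD finA fg intg; have mA := finite_set_measurable finA.
have /measurable_EFinP mg := measurable_int _ intg.
have mf : measurable_fun D f.
  apply: measurable_fun_finite finA _ fg => //.
  by apply: measurable_funS mg => //; exact: subDsetl.
have mfE : measurable_fun D (EFin \o f) by exact/measurable_EFinP.
have := @negligible_integrable _ _ _ mu D A _ mA mD mfE (finite_set_lebesgue0 finA).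
move=> -[_]; apply.
have mDA : measurable (D `\` A) by exact: measurableD.
apply: (@eq_integrable _ _ _ mu (D `\` A) mDA (EFin \o g)) => //.
  by move=> s; rewrite inE => -[Ds As] /=; rewrite fg.
by apply: integrableS intg => //; exact: subDsetl.
Qed.

Variables t0 t1 : R.
Hypothesis t01 : t0 < t1.
Local Notation I01 := (`[t0, t1]%classic : set R).

Lemma cont_pointsP f t : cont_points t0 t1 f t <->
  t0 <= t <= t1 /\ forall e : R, 0 < e -> exists2 d : R, 0 < d &
    forall s, `|s - t| < d -> t0 <= s <= t1 -> `|f t - f s| < e.
Proof.
rewrite /cont_points/= in_itv/=; split=> -[tt h]; split => //.
  by move/cvg_withinP in h => e /h[d d0 {}h]; exists d => // s sd st; apply: h => //=; rewrite in_itv.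
apply/cvg_withinP => e /h[d d0 {}h]; exists d => // s sd; rewrite /= in_itv/=; exact: h.
Qed.

Lemma cont_points_itv f t : cont_points t0 t1 f t -> t0 <= t <= t1.
Proof. by case=> + _; rewrite in_itv. Qed.

(** The points over t of the extended graph: the value at a continuity point, either one-sided limit
    at a discontinuity. It mirrors [ext_graph], with [f] in the place of the Caputo derivative. *)
Definition limit_value f t v : Prop :=
  (cont_points t0 t1 f t /\ v = f t) \/
  ((I01 `\` cont_points t0 t1 f) t /\ (f @ t^'- --> v \/ f @ t^'+ --> v)).

Lemma PC_right f t : PC t0 t1 f -> t0 <= t < t1 ->
  exists2 v : R, limit_value f t v & f @ t^'+ --> v.
Proof.
move=> [_ sub lims] /andP[t0t tt1].
have It : I01 t by rewrite /= in_itv/= t0t ltW.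
have [ct|nct] := pselect (cont_points t0 t1 f t).
  exists (f t); first by left.
  apply/cvg_withinP => e e0; have [_ /(_ e e0)[d d0 h]] := (cont_pointsP f t).1 ct.
  exists (Num.min d (t1 - t)); first by rewrite lt_min d0 subr_gt0.
  move=> s; rewrite lt_min => /andP[std stt] ts; apply: h => //.
  rewrite (ltW (le_lt_trans t0t ts))/=; move: stt.
  rewrite gtr0_norm ?subr_gt0//; lra.
have [_ /cvg_ex[v fv]] := lims t (conj It nct).
by exists v => //; right; split => //; right.
Qed.

Lemma PC_left f t : PC t0 t1 f -> t0 < t <= t1 ->
  exists2 v : R, limit_value f t v & f @ t^'- --> v.
Proof.
move=> [_ sub lims] /andP[t0t tt1].
have It : I01 t by rewrite /= in_itv/= tt1 ltW.
have [ct|nct] := pselect (cont_points t0 t1 f t).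
  exists (f t); first by left.
  apply/cvg_withinP => e e0; have [_ /(_ e e0)[d d0 h]] := (cont_pointsP f t).1 ct.
  exists (Num.min d (t - t0)); first by rewrite lt_min d0 subr_gt0.
  move=> s; rewrite lt_min => /andP[std stt] ts; apply: h => //.
  rewrite (ltW (lt_le_trans ts tt1)) andbT; move: stt.
  rewrite distrC gtr0_norm ?subr_gt0//; lra.
have [/cvg_ex[v fv] _] := lims t (conj It nct).
by exists v => //; right; split => //; left.
Qed.

(* Compactness of [t0, t1]: near a discontinuity both one-sided limits serve as
   the local model of [f]. *)
Lemma PC_uniform f (N : R -> R -> R -> Prop) : PC t0 t1 f ->
  (forall d d' s v, 0 < d' <= d -> N d s v -> N d' s v) ->
  (forall t v, t0 <= t <= t1 -> limit_value f t v -> exists2 d : R, 0 < d &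
     forall s y, `|s - t| < d -> `|v - y| < d -> t0 <= s <= t1 -> N d s y) ->
  exists2 d : R, 0 < d & forall s, cont_points t0 t1 f s -> N d s (f s).
Proof.
move=> PCf mono loc.
have side (A : set R) t v : t0 <= t <= t1 -> limit_value f t v ->
    f @ within A (nbhs t) --> v -> exists2 d : R, 0 < d &
    forall d' s, 0 < d' <= d -> `|s - t| < d -> A s -> t0 <= s <= t1 -> N d' s (f s).
  move=> It tv /cvg_withinP fv; have [d d0 h] := loc t v It tv.
  have [d1 d10 h1] := fv _ d0.
  exists (Num.min d d1); first by rewrite lt_min d0.
  move=> d' s; rewrite le_min lt_min => /and3P[d'0 d'd _] /andP[sd sd1] As Is.
  by apply: (mono d) => //; [rewrite d'0|apply: h => //; exact: h1].
have local t : t0 <= t <= t1 -> exists2 d : R, 0 < d & forall d' s, 0 < d' <= d ->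
    `|s - t| < d -> cont_points t0 t1 f s -> N d' s (f s).
  move=> It; have [ct|nct] := pselect (cont_points t0 t1 f t).
    have [||d d0 h] := side I01 t (f t) It; first by left.
      by case: ct.
    exists d => // d' s d'd sd cs; have Is := cont_points_itv cs.
    by apply: h => //; rewrite /= in_itv.
  have [_ /(_ t)/= sub _] := PCf.
  have /andP[t0t tt1] : t0 < t < t1.
    by have := sub _; rewrite in_itv/=; apply; split.
  have [v1 lv1 fv1] : exists2 v : R, limit_value f t v & f @ t^'- --> v.
    by apply: PC_left => //; rewrite t0t ltW.
  have [v2 lv2 fv2] : exists2 v : R, limit_value f t v & f @ t^'+ --> v.
    by apply: PC_right => //; rewrite tt1 ltW.
  have [d1 d10 h1] := side _ _ _ It lv1 fv1.
  have [d2 d20 h2] := side _ _ _ It lv2 fv2.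
  exists (Num.min d1 d2); first by rewrite lt_min d10.
  move=> d' s; rewrite le_min lt_min => /and3P[d'0 d'd1 d'd2] /andP[sd1 sd2] cs.
  have Is := cont_points_itv cs.
  have [st|ts|ts] := ltgtP s t; last by rewrite -ts in nct.
    by apply: h1 => //; rewrite d'0.
  by apply: h2 => //; rewrite d'0.
(* The near-covering form of compactness is used with the radii as parameter, along the filter
   [0^'+]: a property that holds locally for all small radii holds on the whole segment for all
   small radii. *)
have /compact_near_coveringP := @segment_compact R t0 t1.
move=> /(_ R (0^'+) (fun d s => cont_points t0 t1 f s -> N d s (f s))) [].
  move=> t; rewrite /= in_itv/= => /local[d d0 h].
  exists ([set s | `|s - t| < d], [set d' | 0 < d' <= d]) => /=.
    split; first by apply/near_nbhsP; exists d.
    suff : \forall s \near (0 : R), 0 < s -> 0 < s <= d by [].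
    apply/near_nbhsP; exists d => // s.
    by rewrite subr0 => sd s0; rewrite s0 (le_trans (ler_norm s))// ltW.
  by move=> [s d'] /= [sd d'd] cs; exact: h.
move=> d /= d0 h.
exists (d / 2); first by rewrite divr_gt0.
move=> s cs; apply: (h (d / 2)) => //.
- by rewrite /= sub0r normrN gtr0_norm ?divr_gt0//; lra.
- by rewrite divr_gt0.
- by case: cs.
Qed.

Lemma finite_set_bounded A f : finite_set A ->
  exists M : R, forall s, A s -> `|f s| <= M.
Proof.
move=> /finite_seqP[r ->]; exists (\sum_(x <- r) `|f x|) => s /= sr.
by rewrite (big_rem s)//= lerDl sumr_ge0.
Qed.

(** The bound 1/d gets weaker as d decreases, as [PC_uniform] demands of its predicate. That lemma
    controls continuity points only; the values at the discontinuities are arbitrary but finitely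
    many. *)
Lemma PC_bounded f : PC t0 t1 f ->
  exists2 M : R, 0 < M & forall s, t0 <= s <= t1 -> `|f s| <= M.
Proof.
move=> PCf; have [finA _ _] := PCf.
have [M1 h1] := finite_set_bounded f finA.
have [||d d0 h] := @PC_uniform f (fun d _ v => `|v| <= d^-1) PCf.
- move=> d d' _ v /andP[d'0 d'd] /le_trans; apply.
  by rewrite lef_pV2 ?posrE// (lt_le_trans d'0).
- move=> t v _ _; have v1 : 0 < `|v| + 1 by rewrite ltr_wpDl.
  exists (`|v| + 1)^-1; first by rewrite invr_gt0.
  move=> s y _ vy _; rewrite invrK -lerBlDl.
  rewrite (le_trans (lerB_dist _ _))// distrC (le_trans (ltW vy))//.
  by rewrite invf_le1// lerDr.
exists (Num.max d^-1 M1); first by rewrite lt_max invr_gt0 d0.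
move=> s Is; rewrite le_max.
have [cs|ncs] := pselect (cont_points t0 t1 f s); first by rewrite h.
by rewrite h1 ?orbT//; split => //=; rewrite in_itv.
Qed.

Lemma measurable_finite_discontinuity f :
  finite_set (I01 `\` cont_points t0 t1 f) -> measurable_fun I01 f.
Proof.
move=> finA; apply: (measurable_fun_finite _ finA (g := f)) => //.
have -> : I01 `\` (I01 `\` cont_points t0 t1 f) = cont_points t0 t1 f.
  rewrite setDD; apply/seteqP; split => [s []//|s cs]; split => //.
  by rewrite /= in_itv; exact: cont_points_itv cs.
apply: subspace_continuous_measurable_fun.
  rewrite (_ : cont_points _ _ _ = I01 `\` (I01 `\` cont_points t0 t1 f)).
    by apply: measurableD => //; exact: finite_set_measurable.
  rewrite setDD; apply/seteqP; split => [s cs|s []//]; split => //.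
  by rewrite /= in_itv; exact: cont_points_itv cs.
apply/subspace_continuousP => s /cont_pointsP[Is h].
apply/cvg_withinP => e /h[d d0 {}h]; exists d => // u us cu; apply: h => //.
exact: cont_points_itv cu.
Qed.

Lemma PC_measurable f : PC t0 t1 f -> measurable_fun I01 f.
Proof. by case=> ? _ _; exact: measurable_finite_discontinuity. Qed.

Lemma PC_integrable f : PC t0 t1 f -> mu.-integrable I01 (EFin \o f).
Proof.
move=> PCf; have [M _ fM] := PC_bounded PCf.
apply: (@integrable_bounded _ _ _ M) => //.
- by rewrite lebesgue_measure_itv/= lte_fin t01 ltry.
- exact: PC_measurable.
Qed.

Lemma integrableM_PC w f : mu.-integrable I01 (EFin \o w) -> PC t0 t1 f ->
  mu.-integrable I01 (EFin \o (fun s => w s * f s)).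
Proof.
move=> intw PCf; have [M M0 fM] := PC_bounded PCf.
have /measurable_EFinP mw := measurable_int _ intw.
apply: (@integrable_dominated _ _ _ (fun s => M * `|w s|)) => //.
- by apply: measurable_funM => //; exact: PC_measurable.
- move=> s; rewrite /= in_itv/= => Is; rewrite normrM mulrC.
  by rewrite ler_wpM2r// fM.
- by apply: integrableZlr => //; exact: integrable_norm.
Qed.

Lemma cont_points_comb c d f g t : cont_points t0 t1 f t -> cont_points t0 t1 g t ->
  cont_points t0 t1 (fun s => c * f s + d * g s) t.
Proof.
move=> [It ft] [_ gt]; split => //.
by apply: cvgD; apply: cvgMr.
Qed.

Lemma PC_comb c d f g : PC t0 t1 f -> PC t0 t1 g ->
  PC t0 t1 (fun s => c * f s + d * g s).
Proof.
move=> PCf PCg; have [finf subf _] := PCf; have [fing subg _] := PCg.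
have sub : I01 `\` cont_points t0 t1 (fun s => c * f s + d * g s) `<=`
    (I01 `\` cont_points t0 t1 f) `|` (I01 `\` cont_points t0 t1 g).
  move=> s [Is ncs]; have [cf|ncf] := pselect (cont_points t0 t1 f s).
    right; split => // cg; apply: ncs; exact: cont_points_comb.
  by left.
have subo : I01 `\` cont_points t0 t1 (fun s => c * f s + d * g s) `<=` `]t0, t1[%classic.
  by move=> s /sub[/subf|/subg].
split; [by apply: (sub_finite_set sub); rewrite finite_setU|exact: subo|].
move=> t /subo; rewrite /= in_itv/= => /andP[t0t tt1].
have l1 : t0 < t <= t1 by rewrite t0t ltW.
have l2 : t0 <= t < t1 by rewrite tt1 ltW.
have [v1 _ fv1] := PC_left PCf l1; have [v2 _ fv2] := PC_right PCf l2.
have [u1 _ gu1] := PC_left PCg l1; have [u2 _ gu2] := PC_right PCg l2.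
split; apply/cvg_ex.
  by exists (c * v1 + d * u1); apply: cvgD; apply: cvgMr.
by exists (c * v2 + d * u2); apply: cvgD; apply: cvgMr.
Qed.

Lemma within_continuousP f : {within I01, continuous f} <->
  I01 `<=` cont_points t0 t1 f.
Proof.
split=> [/subspace_continuousP h s Is|h].
  by split => //; exact: h.
by apply/subspace_continuousP => s /h[].
Qed.

Lemma continuous_PC f : {within I01, continuous f} -> PC t0 t1 f.
Proof.
move=> /within_continuousP h.
have e : I01 `\` cont_points t0 t1 f = set0.
  by apply/seteqP; split => // s [/h].
by split; rewrite e// => s [].
Qed.

Lemma continuous_uncurry3P (Phi : R -> R -> R -> R) t x y :
  {for (t, x, y), continuous (uncurry3 Phi)} -> forall e : R, 0 < e ->
  exists2 d : R, 0 < d & forall t' x' y', `|t - t'| < d -> `|x - x'| < d ->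
    `|y - y'| < d -> `|Phi t x y - Phi t' x' y'| < e.
Proof.
move=> /cvgrPdist_lt h e /h /nbhs_ballP[d /= d0 {}h]; exists d => // t' x' y' ht hx hy.
by apply: (h (t', x', y')); split => //; split.
Qed.

Section composition.
Variables (Phi : R -> R -> R -> R) (x f : R -> R).
Hypotheses (cx : {within I01, continuous x}) (PCf : PC t0 t1 f).
Hypothesis cPhi : forall t v, limit_value f t v ->
  {for (t, x t, v), continuous (uncurry3 Phi)}.
Let g t := Phi t (x t) (f t).

(** One-sided filters at t are not confined to the segment, while x is continuous only within it;
    the third hypothesis says that the side A lies in the segment near t. *)
Let cvg_comp3 A t v : t0 <= t <= t1 -> limit_value f t v ->
  (exists2 d : R, 0 < d & forall s, `|s - t| < d -> A s -> t0 <= s <= t1) ->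
  f @ within A (nbhs t) --> v -> g @ within A (nbhs t) --> Phi t (x t) v.
Proof.
move=> It lv [d0 d00 Ad0] /cvg_withinP fv; apply/cvg_withinP => e e0.
have [d d_gt0 h] := continuous_uncurry3P (cPhi lv) e0.
have [d1 d10 h1] := fv _ d_gt0.
have /within_continuousP/(_ t) := cx; rewrite /= in_itv/= => /(_ It).
move=> /cont_pointsP[_ /(_ _ d_gt0)[d2 d20 h2]].
exists (Num.min (Num.min d0 d) (Num.min d1 d2)); first by rewrite !lt_min d00 d_gt0 d10.
move=> s; rewrite !lt_min => /andP[/andP[sd0 sd] /andP[sd1 sd2]] As.
apply: h; [by rewrite distrC|apply: h2 => //; exact: Ad0|exact: h1].
Qed.

Lemma cont_points_comp t : cont_points t0 t1 f t -> cont_points t0 t1 g t.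
Proof.
move=> ct; have It := cont_points_itv ct.
split; first by rewrite in_itv.
apply: cvg_comp3 => //; first by left.
  by exists 1 => // s _; rewrite /= in_itv.
by case: ct.
Qed.

(** Continuity of [Phi] at the limit values is all that one-sided limits of the composite require;
    the value of f at a discontinuity never enters. *)
Lemma PC_comp : PC t0 t1 g.
Proof.
have [finf subf _] := PCf.
have sub : I01 `\` cont_points t0 t1 g `<=` I01 `\` cont_points t0 t1 f.
  by move=> s [Is ncs]; split => // /cont_points_comp.
split; [exact: sub_finite_set sub _|by move=> s /sub/subf|].
move=> t /sub/subf; rewrite /= in_itv/= => /andP[t0t tt1].
have It : t0 <= t <= t1 by rewrite !ltW.
have l1 : t0 < t <= t1 by rewrite t0t ltW.
have l2 : t0 <= t < t1 by rewrite tt1 ltW.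
have [v1 lv1 fv1] := PC_left PCf l1; have [v2 lv2 fv2] := PC_right PCf l2.
split; apply/cvg_ex.
  exists (Phi t (x t) v1); apply: cvg_comp3 => //.
  exists (t - t0); first by rewrite subr_gt0.
  move=> s st ts; rewrite (ltW (lt_trans ts tt1)) andbT; move: st.
  rewrite distrC gtr0_norm ?subr_gt0//; lra.
exists (Phi t (x t) v2); apply: cvg_comp3 => //.
exists (t1 - t); first by rewrite subr_gt0.
move=> s st ts; rewrite (ltW (lt_trans t0t ts))/=; move: st.
rewrite gtr0_norm ?subr_gt0//; lra.
Qed.
End composition.

Lemma cont_points_finite A f g t : finite_set A ->
  (forall s, t0 <= s <= t1 -> ~ A s -> f s = g s) -> f t = g t ->
  cont_points t0 t1 g t -> cont_points t0 t1 f t.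
Proof.
move=> finA fg ftgt /cont_pointsP[It h]; apply/cont_pointsP; split => // e /h[d d0 {}h].
have /near_nbhsP[d1 d10 h1] := finite_set_nbhs t finA.
exists (Num.min d d1); first by rewrite lt_min d0.
move=> s; rewrite lt_min => /andP[sd sd1] Is; rewrite ftgt.
have [->|st] := eqVneq s t; first by rewrite ftgt h ?subrr ?normr0.
rewrite fg//; first exact: h.
by move=> /(h1 _ sd1)/eqP; rewrite (negbTE st).
Qed.

(** The agreement at every continuity point of g keeps f from acquiring new discontinuities, in
    particular at t0 and t1, where [PC] forbids them. *)
Lemma PC_finite A f g : finite_set A ->
  (forall s, t0 <= s <= t1 -> ~ A s -> f s = g s) ->
  (forall s, cont_points t0 t1 g s -> f s = g s) ->
  PC t0 t1 g -> PC t0 t1 f.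
Proof.
move=> finA fg fgc PCg; have [fing subg _] := PCg.
have sub : I01 `\` cont_points t0 t1 f `<=` I01 `\` cont_points t0 t1 g.
  move=> s [Is ncs]; split => // cg; apply: ncs.
  exact: (cont_points_finite finA fg (fgc _ cg) cg).
split; [exact: sub_finite_set sub _|by move=> s /sub/subg|].
move=> t /sub/subg; rewrite /= in_itv/= => /andP[t0t tt1].
have l1 : t0 < t <= t1 by rewrite t0t ltW.
have l2 : t0 <= t < t1 by rewrite tt1 ltW.
have [v1 _ gv1] := PC_left PCg l1; have [v2 _ gv2] := PC_right PCg l2.
have /near_nbhsP[d1 d10 h1] := finite_set_nbhs t finA.
have dt : 0 < Num.min d1 (Num.min (t - t0) (t1 - t)).
  by rewrite !lt_min d10 !subr_gt0 t0t.
have fgt s : `|s - t| < Num.min d1 (Num.min (t - t0) (t1 - t)) -> s != t -> f s = g s.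
  rewrite !lt_min => /and3P[sd1 sd2 sd3] st; apply: fg.
    by move: sd2 sd3; rewrite !ltr_norml => /andP[? ?] /andP[? ?]; apply/andP; split; lra.
  by move=> /(h1 _ sd1)/eqP; rewrite (negbTE st).
split; apply/cvg_ex.
  exists v1; apply/cvg_withinP => e e0; have /cvg_withinP/(_ e e0)[d d0 h] := gv1.
  exists (Num.min d (Num.min d1 (Num.min (t - t0) (t1 - t)))); first by rewrite lt_min d0.
  by move=> s; rewrite lt_min => /andP[sd sd1] ts; rewrite fgt ?lt_eqF//; exact: h.
exists v2; apply/cvg_withinP => e e0; have /cvg_withinP/(_ e e0)[d d0 h] := gv2.
exists (Num.min d (Num.min d1 (Num.min (t - t0) (t1 - t)))); first by rewrite lt_min d0.
by move=> s; rewrite lt_min => /andP[sd sd1] ts; rewrite fgt ?gt_eqF//; exact: h.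
Qed.

End piecewise_continuous.

(** * The Caputo derivative of a function of class PC^alpha *)

Section fractional_composition.
Context {R : realType}.
Local Notation mu := (@lebesgue_measure R).
Implicit Types (A : set R) (a b c d e t s v : R) (f g psi : R -> R).

Section kernel.
Variables (a t0 t : R).
Hypothesis a01 : 0 < a < 1.

(** With z = (s, v), this is the kernel of the double integral behind I^(1-a) I^a at t, cut off to
    the triangle t0 <= v < s <= t. *)
Let k (z : R * R) : R := if [&& t0 <= z.2, z.2 < z.1 & z.1 <= t] then
  (t - z.1) `^ (- a) * (z.1 - z.2) `^ (a - 1) else 0.

Let mk : measurable_fun [set: R * R] k.
Proof.
apply: measurable_fun_ifT => //.
- apply: measurable_and; first exact: measurable_fun_ler.
  apply: measurable_and; first exact: measurable_fun_ltr.
  exact: measurable_fun_ler.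
- apply: measurable_funM.
    apply: (@measurableT_comp _ _ _ _ _ _ (@powR R ^~ (- a))) => //.
    exact: measurable_funB.
  apply: (@measurableT_comp _ _ _ _ _ _ (@powR R ^~ (a - 1))) => //.
  exact: measurable_funB.
Qed.

Let k_ge0 z : 0 <= k z.
Proof. by rewrite /k; case: ifPn => // _; rewrite mulr_ge0 ?powR_ge0. Qed.

Let int_k v : (\int[mu]_s (k (s, v))%:E =
  (if t0 <= v < t then betaC a else 0)%:E)%E.
Proof.
rewrite /k /=; have [t0v|vt0] := leP t0 v => /=; last first.
  by apply: integral0_eq.
have [vt|tv] := ltP v t; last first.
  apply: integral0_eq => s _; case: ifPn => // /andP[vs st].
  by have := lt_le_trans (lt_le_trans vs st) tv; rewrite ltxx.
rewrite -(integral_beta_kernel a01 vt) integral_itv_bndoo; last first.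
  apply/measurable_EFinP/measurable_funM; first exact: measurable_powR_subr.
  exact: measurable_powR_subl.
rewrite -(integral_itv_bndoo false false); last first.
  apply/measurable_EFinP/measurable_funM; first exact: measurable_powR_subr.
  exact: measurable_powR_subl.
rewrite [RHS]integral_mkcond; apply: eq_integral => s _.
by rewrite patchE mem_setE in_itv/=; case: ifPn.
Qed.

Variable psi : R -> R.
Variable M : R.
Hypotheses (mpsi : measurable_fun [set: R] psi) (psiM : forall s, `|psi s| <= M).

Let f (z : R * R) : R := k z * psi z.2.

Let mf : measurable_fun [set: R * R] f.
Proof. by apply: measurable_funM => //; exact: measurableT_comp. Qed.

(** Integrating |f| over s first gives at most [M * betaC a] for v in [[t0, t[] and 0 elsewhere,
    hence a finite double integral. *)
Let intf : (mu \x mu)%E.-integrable [set: R * R] (EFin \o f).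
Proof.
have M0 : 0 <= M by rewrite (le_trans _ (psiM 0)).
apply/integrable21ltyP; first exact/measurable_EFinP.
pose h v : R := if t0 <= v < t then M * betaC a else 0.
have h0 v : 0 <= h v.
  by rewrite /h; case: ifPn => // _; rewrite mulr_ge0// ltW// beta_gt0.
have hE v : (h v)%:E = (\int[mu]_s (M * k (s, v))%:E)%E.
  under eq_integral do rewrite EFinM.
  have mkv : measurable_fun [set: R] (fun s => (k (s, v))%:E).
    by apply/measurable_EFinP; exact: measurableT_comp.
  have k0 s : [set: R] s -> (0 <= (k (s, v))%:E)%E by rewrite lee_fin.
  rewrite (@ge0_integralZl_EFin _ _ _ mu _ measurableT _ k0 mkv _ M0) int_k.
  by rewrite /h -EFinM; case: ifPn; rewrite ?mulr0.
apply: (@le_lt_trans _ _ (\int[mu]_v (h v)%:E)%E).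
  apply: ge0_le_integral => //.
  - by move=> v _; exact: integral_ge0.
  - apply: (@measurable_fun_fubini_tonelli_G _ _ _ _ _ mu (fun z => `|(f z)%:E|%E)) => //.
    by apply: measurableT_comp => //; exact/measurable_EFinP.
  - apply/measurable_EFinP; apply: measurable_fun_ifT => //.
    apply: measurable_and; first exact: measurable_fun_ler.
    exact: measurable_fun_ltr.
  - move=> v _; rewrite hE; apply: ge0_le_integral => //.
    + apply: measurableT_comp => //; apply/measurable_EFinP.
      by apply: (@measurableT_comp _ _ _ _ _ _ f).
    + apply/measurable_EFinP; apply: measurable_funM => //.
      by apply: (@measurableT_comp _ _ _ _ _ _ k).
    + move=> s _; rewrite lee_fin /f normrM (ger0_norm (k_ge0 _)) mulrC.
      by rewrite ler_wpM2r.
rewrite (_ : \int[mu]_v _ = \int[mu]_(v in `[t0, t[) (M * betaC a)%:E)%E; last first.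
  rewrite [RHS]integral_mkcond; apply: eq_integral => v _.
  by rewrite patchE mem_setE in_itv/= /h; case: ifPn.
rewrite integral_cst//= lebesgue_measure_itv/=.
by case: ifPn => _; rewrite ?mule0// -EFinD -EFinM ltry.
Qed.

Let K s : R := \int[mu]_(v in `[t0, s]) ((s - v) `^ (a - 1) * psi v).

Let int_f s : t0 <= s <= t ->
  (\int[mu]_v (f (s, v))%:E = ((t - s) `^ (- a) * K s)%:E)%E.
Proof.
move=> /andP[t0s st]; have a0 : 0 < a by case/andP: a01.
have intk : mu.-integrable `[t0, s] (EFin \o (fun v => (s - v) `^ (a - 1) * psi v)).
  apply: (@integrable_dominated _ _ _ (fun v => M * (s - v) `^ (a - 1))) => //.
  - by apply: measurable_funM; [exact: measurable_powR_subr|exact: measurable_funTS].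
  - by move=> v _; rewrite normrM ger0_norm ?powR_ge0// mulrC ler_wpM2r// powR_ge0.
  - by apply: integrableZlr => //; exact: integrable_powR_subr.
have mkp : measurable_fun [set: R] (fun v => (t - s) `^ (- a) * ((s - v) `^ (a - 1) * psi v)).
  apply: measurable_funM => //; apply: measurable_funM => //.
  exact: measurable_powR_subr.
transitivity (\int[mu]_(v in `[t0, s]) ((t - s) `^ (- a) * ((s - v) `^ (a - 1) * psi v))%:E)%E.
  rewrite -integral_itv_bndo_bndc; last first.
    by apply: measurable_funTS; exact/measurable_EFinP.
  rewrite [RHS]integral_mkcond; apply: eq_integral => v _.
  rewrite patchE mem_setE in_itv/= /f /k /= st andbT.
  by case: ifPn; rewrite ?mul0r// mulrA.
rewrite EFinM /K /Rintegral fineK; last exact: integrable_fin_num.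
have := @integralZl _ _ _ mu _ (measurable_itv `[t0, s]) _ intk ((t - s) `^ (- a)).
by move=> /= <-; apply: eq_integral => v _; rewrite EFinM.
Qed.

Lemma integrable_fractional_kernel : mu.-integrable `[t0, t]
  (EFin \o (fun s => (t - s) `^ (- a) * K s)).
Proof.
have := @integrable_fubini_F _ _ _ _ _ mu mu _ intf.
move=> intF; have {intF} : mu.-integrable `[t0, t] (fubini_F mu (EFin \o f)).
  exact: (@integrableS _ _ _ mu setT `[t0, t]%classic).
apply: eq_integrable => // s; rewrite mem_setE in_itv/= => Is.
by rewrite /fubini_F /= int_f.
Qed.

(** The composition rule I^(1-a) I^a = I^1 up to Gamma factors: [K] is the inner fractional
    integral, and after Fubini the kernel integrates in s to the constant [betaC a]. *)
Lemma Rintegral_fractional_kernel :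
  \int[mu]_(s in `[t0, t]) ((t - s) `^ (- a) * K s) =
  betaC a * \int[mu]_(v in `[t0, t]) psi v.
Proof.
have intpsi : mu.-integrable `[t0, t] (EFin \o psi).
  apply: (@integrable_bounded _ _ _ M) => //; last exact: measurable_funTS.
  by rewrite lebesgue_measure_itv/=; case: ifPn => _; rewrite ?ltry.
rewrite -RintegralZl// /Rintegral; congr fine.
transitivity (\int[mu]_s \int[mu]_v (f (s, v))%:E)%E.
  rewrite integral_mkcond; apply: eq_integral => s _.
  rewrite patchE mem_setE in_itv/=; case: ifPn => [Is|nIs]; first by rewrite int_f.
  apply/esym/integral0_eq => v _; rewrite /f /k/=.
  case: ifPn; last by rewrite mul0r.
  by move=> /and3P[h1 h2 h3]; move: nIs; rewrite h3 (le_trans h1 (ltW h2)).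
rewrite (@Fubini _ _ _ _ _ mu mu _ intf).
transitivity (\int[mu]_(v in `[t0, t[) (betaC a * psi v)%:E)%E; last first.
  rewrite integral_itv_bndo_bndc//; apply/measurable_EFinP/measurable_funM => //.
  exact: measurable_funTS.
rewrite [RHS]integral_mkcond; apply: eq_integral => v _.
rewrite patchE mem_setE in_itv/=.
have mkv : measurable_fun [set: R] (fun s => (k (s, v))%:E).
  by apply/measurable_EFinP; exact: measurableT_comp.
have intkv : mu.-integrable [set: R] (EFin \o (fun s => k (s, v))).
  by apply: (ge0_integrable _ _ _ (int_k v)) => //; exact/measurable_EFinP.
rewrite /f/=; under eq_integral do rewrite EFinM.
have := @integralZr _ _ _ mu _ measurableT (EFin \o (fun s => k (s, v))) intkv (psi v).
move=> /= ->; rewrite int_k.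
by case: ifPn => _; rewrite ?mul0e.
Qed.

End kernel.
Variables t0 t1 : R.
Hypothesis t01 : t0 < t1.
Local Notation I01 := (`[t0, t1]%classic : set R).

Lemma sub_itv_t0 t : t0 <= t <= t1 -> (`[t0, t] : set R) `<=` I01.
Proof.
move=> /andP[_ tt1] s; rewrite /= !in_itv/= => /andP[-> st].
exact: le_trans tt1.
Qed.

(** Fubini is applied to psi extended by zero, which is bounded and measurable on the whole line;
    the Beta constant then cancels Gamma(a) Gamma(1-a). *)
Lemma RL_left_comp a psi t : 0 < a < 1 -> PC t0 t1 psi -> t0 <= t <= t1 ->
  RL_left t0 (1 - a) (RL_left t0 a psi) t = \int[mu]_(s in `[t0, t]) psi s.
Proof.
move=> a01 PCpsi It; have [M M0 psiM] := PC_bounded PCpsi.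
pose psi' := psi \_ I01.
have psiE s : t0 <= s <= t1 -> psi' s = psi s.
  by move=> Is; rewrite /psi' patchE mem_setE in_itv/= Is.
have mpsi' : measurable_fun [set: R] psi'.
  by apply/(measurable_restrictT _ _).1 => //; exact: PC_measurable.
have psi'M s : `|psi' s| <= M.
  rewrite /psi' patchE mem_setE in_itv/=; case: ifPn => [/psiM//|_].
  by rewrite normr0 ltW.
have ga : 0 < Gamma a by apply: Gamma_gt0; case/andP: a01 => -> /ltW.
have gb : 0 < Gamma (1 - a).
  by apply: Gamma_gt0; case/andP: a01 => ? ?; rewrite subr_gt0 gerBl ltW// andbT.
rewrite /RL_left.
have := @Rintegral_fractional_kernel a t0 t a01 psi' M mpsi' psi'M.
have := @integrable_fractional_kernel a t0 t a01 psi' M mpsi' psi'M.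
set K := fun s => \int[mu]_(v in `[t0, s]) ((s - v) `^ (a - 1) * psi' v).
move=> intK eqK.
rewrite (_ : \int[mu]_(s in `[t0, t]) _ =
  \int[mu]_(s in `[t0, t]) ((Gamma a)^-1 * ((t - s) `^ (- a) * K s))); last first.
  apply: eq_Rintegral => s; rewrite mem_setE in_itv/= => /andP[t0s st].
  rewrite (_ : 1 - a - 1 = - a); last by ring.
  rewrite mulrCA; congr (_ * (_ * _)); apply: eq_Rintegral => v.
  rewrite mem_setE in_itv/= => /andP[t0v vs]; rewrite psiE// t0v/=.
  by case/andP: It => _; apply: le_trans; exact: le_trans st.
rewrite RintegralZl// eqK -Gamma_mul//.
rewrite (_ : \int[mu]_(s in `[t0, t]) psi s = \int[mu]_(s in `[t0, t]) psi' s).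
  move: (\int[mu]_(s in `[t0, t]) psi' s) (Gamma a) (Gamma (1 - a)) ga gb.
  by move=> J x y x0 y0; field; rewrite !gt_eqF.
apply: eq_Rintegral => s; rewrite mem_setE in_itv/= => /andP[t0s st].
by rewrite psiE// t0s; case/andP: It => _; apply: le_trans.
Qed.

Lemma Rintegral_itv_diff f a b : mu.-integrable I01 (EFin \o f) ->
  t0 <= a -> a <= b -> b <= t1 ->
  \int[mu]_(s in `[t0, b]) f s - \int[mu]_(s in `[t0, a]) f s =
  \int[mu]_(s in `[a, b]) f s.
Proof.
move=> intf t0a ab bt1.
have intb : mu.-integrable `[t0, b] (EFin \o f).
  apply: integrableS intf => //; apply: sub_itv_t0.
  by rewrite bt1 (le_trans t0a).
rewrite Rintegral_itvB ?bnd_simp// Rintegral_itv_obnd_cbnd//.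
apply: integrableS intb => // s; rewrite /= !in_itv/= => /andP[as_ ->].
by rewrite andbT (le_trans t0a)// ltW.
Qed.

Lemma Rintegral_average_bound f a b c e : mu.-integrable I01 (EFin \o f) ->
  t0 <= a -> a <= b -> b <= t1 ->
  (forall s, a <= s <= b -> `|f s - c| <= e) ->
  `|\int[mu]_(s in `[a, b]) f s - c * (b - a)| <= e * (b - a).
Proof.
move=> intf t0a ab bt1 fce.
have mab : mu `[a, b]%classic = (b - a)%:E.
  rewrite lebesgue_measure_itv/= lte_fin lt_neqAle ab andbT.
  by have [->|] := eqVneq a b; rewrite ?subrr// -EFinD.
have intfab : mu.-integrable `[a, b] (EFin \o f).
  apply: integrableS intf => // s; rewrite /= !in_itv/= => /andP[as_ sb].
  by rewrite (le_trans t0a)//= (le_trans sb).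
have intc k : mu.-integrable `[a, b] (EFin \o cst k).
  by apply: (@integrable_bounded _ _ _ `|k|) => //; rewrite mab ltry.
have -> : c * (b - a) = \int[mu]_(s in `[a, b]) cst c s.
  by rewrite Rintegral_cst//= mab.
rewrite -RintegralB//.
have intfc : mu.-integrable `[a, b] (EFin \o (fun s => f s - cst c s)).
  exact: integrableBr.
apply: (le_trans (le_normr_Rintegral _ intfc)) => //.
have -> : e * (b - a) = \int[mu]_(s in `[a, b]) cst e s.
  by rewrite Rintegral_cst//= mab.
by apply: le_Rintegral => //; exact: integrable_norm.
Qed.

Lemma derive_on_integral f g c t : mu.-integrable I01 (EFin \o f) ->
  (forall s, t0 <= s <= t1 -> g s = c + \int[mu]_(u in `[t0, s]) f u) ->
  cont_points t0 t1 f t -> derive_on t0 t1 g t = f t.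
Proof.
move=> intf gE /cont_pointsP[It ft]; rewrite /derive_on.
(* A limit determines [lim] only along a proper filter, so t must be an accumulation point of the
   segment; at t = t1 it is approached from the left. *)
have FF : ProperFilter (within I01 t^').
  apply: Build_ProperFilter.
  move=> /near_nbhsP[d d0 h].
  have /andP[t0t tt1] := It.
  have [tlt|tge] := ltP t t1.
    pose s := t + Num.min (d / 2) (t1 - t).
    have m0 : 0 < Num.min (d / 2) (t1 - t) by rewrite lt_min divr_gt0// subr_gt0.
    apply: (h s).
    - rewrite /s addrAC subrr add0r gtr0_norm// gt_min; apply/orP; left; lra.
    - by rewrite /s gt_eqF// ltrDl.
    - rewrite /s /= in_itv/=; apply/andP; split.
        by rewrite (le_trans t0t)// lerDl ltW.
      by rewrite -lerBrDl ge_min lexx orbT.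
  pose s := t - Num.min (d / 2) (t1 - t0).
  have m0 : 0 < Num.min (d / 2) (t1 - t0) by rewrite lt_min divr_gt0// subr_gt0.
  apply: (h s).
  - rewrite /s addrAC subrr add0r normrN gtr0_norm// gt_min; apply/orP; left; lra.
  - by rewrite /s lt_eqF// gtrDl oppr_lt0.
  - rewrite /s /= in_itv/=; apply/andP; split; last first.
      by rewrite (le_trans _ tt1)// gerDl oppr_le0 ltW.
    rewrite lerBrDr -lerBrDl ge_min; apply/orP; right; lra.
apply/cvg_lim => //; apply/cvgrPdist_le => e e0.
have [d d0 h] := ft e e0.
suff : \forall s \near t, s != t -> I01 s ->
  `|f t - (s - t)^-1 * (g s - g t)| <= e by [].
apply/near_nbhsP; exists d => // s sd st; rewrite /= in_itv/= => Is.
have key a b : t0 <= a -> a < b -> b <= t1 ->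
    (forall u, a <= u <= b -> `|f u - f t| <= e) ->
    `|f t - (b - a)^-1 * (g b - g a)| <= e.
  move=> t0a ab bt1 fe; have ba0 : 0 < b - a by rewrite subr_gt0.
  rewrite !gE; last 2 first.
  - by rewrite t0a (le_trans (ltW ab)).
  - by rewrite bt1 (le_trans t0a (ltW ab)).
  have := Rintegral_average_bound intf t0a (ltW ab) bt1 fe.
  rewrite -(Rintegral_itv_diff intf t0a (ltW ab) bt1).
  set x := \int[mu]_(u in `[t0, b]) _; set y := \int[mu]_(u in `[t0, a]) _.
  have -> : f t - (b - a)^-1 * (c + x - (c + y)) =
      - ((b - a)^-1 * (x - y - f t * (b - a))) by field; rewrite gt_eqF.
  rewrite normrN normrM (gtr0_norm (_ : 0 < (b - a)^-1)) ?invr_gt0// => le1.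
  by rewrite mulrC ler_pdivrMr.
have /andP[t0t tt1] := It; have /andP[t0s st1] := Is.
have [slt|tls|e1] := ltgtP s t; last by rewrite e1 eqxx in st.
- rewrite (_ : (s - t)^-1 * _ = (t - s)^-1 * (g t - g s)); last first.
    by rewrite -(opprB t s) -(opprB (g t)) invrN mulrNN.
  apply: key => // u /andP[su ut]; rewrite distrC ltW// h//.
    by move: sd; rewrite !ltr_norml => /andP[? ?]; apply/andP; split; lra.
  by rewrite (le_trans t0s su) (le_trans ut tt1).
- apply: key => // u /andP[tu us]; rewrite distrC ltW// h//.
    by move: sd; rewrite !ltr_norml => /andP[? ?]; apply/andP; split; lra.
  by rewrite (le_trans t0t tu) (le_trans us st1).
Qed.

Lemma RL_left1 psi t : RL_left t0 1 psi t = \int[mu]_(s in `[t0, t]) psi s.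
Proof.
rewrite /RL_left Gamma1 invr1 mul1r; apply: eq_Rintegral => s _.
by rewrite subrr powRr0 mul1r.
Qed.

(** In both branches of [caputo] the function being differentiated is, up to a constant, the
    integral of psi: directly for a = 1, through [RL_left_comp] for a < 1. *)
Lemma caputo_PCa a x psi t : 0 < a <= 1 -> PC t0 t1 psi ->
  (forall s, t0 <= s <= t1 -> x s = x t0 + RL_left t0 a psi s) ->
  cont_points t0 t1 psi t -> caputo t0 t1 a x t = psi t.
Proof.
move=> /andP[a0 a1] PCpsi xE ct; have intpsi := PC_integrable t01 PCpsi.
rewrite /caputo; case: eqVneq => [a_eq1|a_neq1].
  apply: (derive_on_integral (c := x t0)) => // s Is.
  by rewrite xE// a_eq1 RL_left1.
have a01 : 0 < a < 1 by rewrite a0 lt_neqAle a_neq1.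
apply: (derive_on_integral (c := 0)) => // s Is.
rewrite add0r -(RL_left_comp a01 PCpsi Is) /RL_left.
congr (_ * _); apply: eq_Rintegral => u; rewrite mem_setE in_itv/= => /andP[t0u us].
congr (_ * _); rewrite -/(RL_left t0 a psi u) (xE u); last first.
  by rewrite t0u; case/andP: Is => _; apply: le_trans.
by rewrite addrC addKr.
Qed.

End fractional_composition.

(** * Differentiability of the functionals *)

Section strict_differentiability.
Context {R : realType}.
Implicit Types (L : R -> R -> R -> R) (f : R -> R) (a b c d e t x y u v : R).

Lemma MVT_unordered f a b :
  (forall c, Num.min a b <= c <= Num.max a b -> derivable f c 1) ->
  exists2 c : R, Num.min a b <= c <= Num.max a b & f b - f a = derive1 f c * (b - a).
Proof.
wlog ab : a b / a <= b => [hw|] df.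
  case/orP: (le_total a b) => [ab|ba]; first exact: hw ab df.
  have [|c cab e] := hw b a ba; first by move=> c; rewrite minC maxC; exact: df.
  exists c; first by rewrite minC maxC.
  by rewrite -opprB e -mulrN opprB.
have [||c] := @MVT_segment R f (derive1 f) a b ab.
- move=> c; rewrite in_itv/= => /andP[ac cb]; rewrite derive1E.
  by apply/derivableP/df; rewrite min_l// max_r// !ltW.
- apply: derivable_within_continuous => c; rewrite in_itv/= => cab.
  by apply: df; rewrite min_l// max_r.
- by rewrite in_itv/= => cab e; exists c => //; rewrite min_l// max_r.
Qed.

Lemma dist_between a b c x d : `|x - a| < d -> `|x - b| < d ->
  Num.min a b <= c <= Num.max a b -> `|x - c| < d.
Proof.
rewrite ge_min le_max !ltr_norml => /andP[? ?] /andP[? ?] /andP[/orP[?|?] /orP[?|?]];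
  apply/andP; split; lra.
Qed.

Variables (L : R -> R -> R -> R) (U : set (R * R * R)).
Hypothesis openU : open U.
Hypothesis C1U : forall t x y, U (t, x, y) ->
  [/\ derivable (fun u => L t u y) x 1,
      derivable (fun u => L t x u) y 1,
      {for (t, x, y), continuous (uncurry3 L)},
      {for (t, x, y), continuous (uncurry3 (partial_x L))} &
      {for (t, x, y), continuous (uncurry3 (partial_y L))}].

Lemma open3P t x y : U (t, x, y) -> exists2 d : R, 0 < d &
  forall t' x' y', `|t - t'| < d -> `|x - x'| < d -> `|y - y'| < d ->
    U (t', x', y').
Proof.
move=> Up; have : nbhs (t, x, y) U by exact: open_nbhs_nbhs.
move=> /nbhs_ballP[d /= d0 h]; exists d => // t' x' y' ht hx hy.
by apply: h; split => //; split.
Qed.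

(** The increment is split into one step in y and one in x, and the mean value theorem is applied to
    each; the partial derivatives met on the way differ from those at the base point by at most e.
    The base point is itself allowed to move, so that the estimate can be spread along the graph by
    compactness. *)
Lemma strict_differentiability_local t x y e : U (t, x, y) -> 0 < e ->
  exists2 d : R, 0 < d & forall t' x' y' u v u' v',
    `|t - t'| < d -> `|x - x'| < d -> `|y - y'| < d ->
    `|u| <= d -> `|v| <= d -> `|u'| <= d -> `|v'| <= d ->
    U (t', x' + u, y' + v) /\
    `|L t' (x' + u) (y' + v) - L t' (x' + u') (y' + v')
      - (partial_x L t' x' y' * (u - u') + partial_y L t' x' y' * (v - v'))|
      <= e * (`|u - u'| + `|v - v'|).
Proof.
move=> Up e0; have e20 : 0 < e / 2 by rewrite divr_gt0.
have [d0 d00 hU] := open3P Up.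
have [_ _ _ /continuous_uncurry3P/(_ _ e20)[d1 d10 hx]
  /continuous_uncurry3P/(_ _ e20)[d2 d20 hy]] := C1U Up.
(* Halving leaves room for two displacements, that of the base point and that of the increment. *)
pose d : R := Num.min d0 (Num.min d1 d2) / 2.
have d_gt0 : 0 < d by rewrite divr_gt0// !lt_min d00 d10.
have ltd (z : R) : `|z| < d + d -> [/\ `|z| < d0, `|z| < d1 & `|z| < d2].
  rewrite /d -splitr !lt_min => /and3P[? ? ?]; by split.
exists d => // t' x' y' u v u' v' ht0 hx0 hy0 ud vd u'd v'd.
have ht : `|t - t'| < d + d by rewrite (lt_trans ht0)// ltrDl.
have near0 (z z' w : R) : `|z - z'| < d -> `|w| <= d -> `|z - (z' + w)| < d + d.
  move=> zz' wd; rewrite opprD addrA (le_lt_trans (ler_normB _ _))//.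
  exact: ltr_leD.
have near1 (z z' : R) : `|z - z'| < d -> `|z - z'| < d + d.
  by move=> zz'; rewrite (lt_trans zz')// ltrDl.
have inU (x2 y2 : R) : `|x - x2| < d + d -> `|y - y2| < d + d -> U (t', x2, y2).
  by move=> /ltd[? _ _] /ltd[? _ _]; apply: hU => //; case: (ltd _ ht).
have dx (x2 y2 : R) : `|x - x2| < d + d -> `|y - y2| < d + d ->
    `|partial_x L t' x2 y2 - partial_x L t' x' y'| <= e.
  move=> /ltd[_ ? _] /ltd[_ ? _]; have [_ ? _] := ltd _ ht.
  have [_ ? _] := ltd _ (near1 _ _ hx0); have [_ ? _] := ltd _ (near1 _ _ hy0).
  rewrite ltW// (splitr e) (le_lt_trans (ler_distD (partial_x L t x y) _ _))//.
  by apply: ltrD; [rewrite distrC|]; apply: hx.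
have dy (x2 y2 : R) : `|x - x2| < d + d -> `|y - y2| < d + d ->
    `|partial_y L t' x2 y2 - partial_y L t' x' y'| <= e.
  move=> /ltd[_ _ ?] /ltd[_ _ ?]; have [_ _ ?] := ltd _ ht.
  have [_ _ ?] := ltd _ (near1 _ _ hx0); have [_ _ ?] := ltd _ (near1 _ _ hy0).
  rewrite ltW// (splitr e) (le_lt_trans (ler_distD (partial_y L t x y) _ _))//.
  by apply: ltrD; [rewrite distrC|]; apply: hy.
split; first by apply: inU; exact: near0.
have [|c1 c1P e1] := @MVT_unordered (fun z => L t' z (y' + v)) (x' + u') (x' + u).
  move=> c cP; have xc : `|x - c| < d + d by apply: dist_between cP; exact: near0.
  by have [] := C1U (inU c (y' + v) xc (near0 _ _ _ hy0 vd)).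
have xc1 : `|x - c1| < d + d by apply: dist_between c1P; exact: near0.
have [|c2 c2P e2] := @MVT_unordered (fun z => L t' (x' + u') z) (y' + v') (y' + v).
  move=> c cP; have yc : `|y - c| < d + d by apply: dist_between cP; exact: near0.
  by have [] := C1U (inU (x' + u') c (near0 _ _ _ hx0 u'd) yc).
have yc2 : `|y - c2| < d + d by apply: dist_between c2P; exact: near0.
have dx1 := dx _ _ xc1 (near0 _ _ _ hy0 vd).
have dy2 := dy _ _ (near0 _ _ _ hx0 u'd) yc2.
rewrite (_ : _ - _ - _ =
  (partial_x L t' c1 (y' + v) - partial_x L t' x' y') * (u - u') +
  (partial_y L t' (x' + u') c2 - partial_y L t' x' y') * (v - v')); last first.
  transitivity ((L t' (x' + u) (y' + v) - L t' (x' + u') (y' + v))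
    + (L t' (x' + u') (y' + v) - L t' (x' + u') (y' + v'))
    - (partial_x L t' x' y' * (u - u') + partial_y L t' x' y' * (v - v'))).
    by ring.
  by rewrite e1 e2 /partial_x /partial_y; ring.
rewrite (le_trans (ler_normD _ _))// [leRHS]mulrDr !normrM.
by apply: lerD; rewrite ler_wpM2r.
Qed.
End strict_differentiability.

(** * Uniform estimates along the graph of x and their integrals *)

Section functional_estimate.
Context {R : realType}.
Local Notation mu := (@lebesgue_measure R).
Implicit Types (A : set R) (a b c d e t s : R) (f g u v x : R -> R).

Variables t0 t1 : R.
Hypothesis t01 : t0 < t1.
Local Notation I01 := (`[t0, t1]%classic : set R).

Lemma RL_left_finite a A f g t : 0 < a -> finite_set A -> PC t0 t1 g ->
  (forall s, t0 <= s <= t1 -> ~ A s -> f s = g s) -> t0 <= t <= t1 ->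
  RL_left t0 a f t = RL_left t0 a g t.
Proof.
move=> a0 finA PCg fg It; congr (_ * _).
apply: (@Rintegral_finite _ _ A) => //.
  apply: measurable_funM; first exact: measurable_powR_subr.
  by apply: measurable_funS (PC_measurable PCg) => //; exact: sub_itv_t0.
move=> s; rewrite /= in_itv/= => /andP[t0s st] As; rewrite fg// t0s.
by case/andP: It => _; exact: le_trans.
Qed.

(** The density psi in [PCa] is only asserted to exist. It agrees with the Caputo derivative off a
    finite set, so the derivative, unspecified values included, can serve as the density. *)
Lemma PCa_caputo a x : 0 < a <= 1 -> PCa t0 t1 a x ->
  PC t0 t1 (caputo t0 t1 a x) /\
  forall t, t0 <= t <= t1 -> x t = x t0 + RL_left t0 a (caputo t0 t1 a x) t.
Proof.
move=> a01 [cx [psi PCpsi xE]]; have [finA _ _] := PCpsi.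
have xE' s : t0 <= s <= t1 -> x s = x t0 + RL_left t0 a psi s.
  by move=> Is; apply: xE; rewrite in_itv.
have DE s : cont_points t0 t1 psi s -> caputo t0 t1 a x s = psi s.
  exact: caputo_PCa.
have DE' s : t0 <= s <= t1 -> ~ (I01 `\` cont_points t0 t1 psi) s ->
    caputo t0 t1 a x s = psi s.
  move=> Is nA; apply: DE; apply: contrapT => nc; apply: nA; split => //.
split; first exact: PC_finite finA DE' DE PCpsi.
move=> t It; rewrite xE' //; congr (_ + _); apply/esym.
by apply: RL_left_finite finA PCpsi DE' It; case/andP: a01.
Qed.

Lemma le_norm_Rintegral_finite A f g : finite_set A ->
  mu.-integrable I01 (EFin \o f) -> mu.-integrable I01 (EFin \o g) ->
  (forall s, I01 s -> 0 <= g s) ->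
  (forall s, I01 s -> ~ A s -> `|f s| <= g s) ->
  `|\int[mu]_(s in I01) f s| <= \int[mu]_(s in I01) g s.
Proof.
move=> finA intf intg g0 fg.
pose f' s := if s \in A then 0 else f s.
have ff' s : I01 s -> ~ A s -> f' s = f s.
  by move=> _ As; rewrite /f' memNset.
have intf' : mu.-integrable I01 (EFin \o f').
  exact: integrable_finite finA ff' intf.
have /measurable_EFinP mf := measurable_int _ intf.
rewrite -(Rintegral_finite _ finA mf ff')//.
apply: (le_trans (le_normr_Rintegral _ intf')) => //.
apply: le_Rintegral => //; first exact: integrable_norm.
move=> s Is; rewrite /f'; case: ifPn => [_|/negP]; first by rewrite normr0 g0.
by rewrite inE => As; rewrite fg.
Qed.

Lemma cont_points_uncurry3 (Phi : R -> R -> R -> R) x f t :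
  cont_points t0 t1 x t -> cont_points t0 t1 f t ->
  {for (t, x t, f t), continuous (uncurry3 Phi)} ->
  cont_points t0 t1 (fun s => Phi s (x s) (f s)) t.
Proof.
move=> /cont_pointsP[It cx] /cont_pointsP[_ cf] /continuous_uncurry3P cPhi.
apply/cont_pointsP; split => // e /cPhi[d d0 h].
have [d1 d10 h1] := cx _ d0; have [d2 d20 h2] := cf _ d0.
exists (Num.min d (Num.min d1 d2)); first by rewrite !lt_min d0 d10.
move=> s; rewrite !lt_min => /and3P[sd sd1 sd2] Is.
by apply: h; [rewrite distrC|exact: h1|exact: h2].
Qed.

Lemma cont_pointsD f g t : cont_points t0 t1 f t -> cont_points t0 t1 g t ->
  cont_points t0 t1 (fun s => f s + g s) t.
Proof. by move=> [It ft] [_ gt]; split => //; exact: cvgD. Qed.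

Section functional.
Variables (a b : R) (x : R -> R) (L : R -> R -> R -> R).
Hypotheses (a01 : 0 < a <= 1) (b0 : 0 < b) (PCx : PCa t0 t1 a x).
Hypothesis C1L : C1xy_near L (ext_graph t0 t1 a x).
Let D := caputo t0 t1 a x.
Let w s := (t1 - s) `^ (b - 1).
Let Lx s := partial_x L s (x s) (D s).
Let Ly s := partial_y L s (x s) (D s).

(** The last argument is D + v rather than the Caputo derivative of x + u. For a variation the two
    agree off a finite set, and here u and v may be estimated independently. *)
Definition perturbed u v : R :=
  \int[mu]_(s in I01) (w s * L s (x s + u s) (D s + v s)).
Definition first_variation u v : R :=
  \int[mu]_(s in I01) (w s * (Lx s * u s + Ly s * v s)).

Let PCD : PC t0 t1 D. Proof. by have [] := PCa_caputo a01 PCx. Qed.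

Let cx t : t0 <= t <= t1 -> cont_points t0 t1 x t.
Proof.
case: PCx => /within_continuousP + _ It; apply.
by rewrite /= in_itv.
Qed.

Let intw : mu.-integrable I01 (EFin \o w).
Proof. exact: integrable_powR_subr (ltW t01) b0. Qed.

Let w_ge0 s : 0 <= w s. Proof. exact: powR_ge0. Qed.

Lemma limit_value_ext_graph t (v : R) :
  limit_value t0 t1 D t v -> ext_graph t0 t1 a x (t, x t, v).
Proof. by move=> [[ct ->]|[nct lv]]; [left; exists t|right; exists t, v]. Qed.

Let L_PC (Phi : R -> R -> R -> R) :
  (forall t y v : R, ext_graph t0 t1 a x (t, y, v) ->
    {for (t, y, v), continuous (uncurry3 Phi)}) ->
  PC t0 t1 (fun s => Phi s (x s) (D s)) /\
  forall t, cont_points t0 t1 D t -> cont_points t0 t1 (fun s => Phi s (x s) (D s)) t.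
Proof.
move=> cPhi; have cPhi' t (v : R) : limit_value t0 t1 D t v ->
    {for (t, x t, v), continuous (uncurry3 Phi)}.
  by move=> /limit_value_ext_graph; exact: cPhi.
case: PCx => cx' _.
by split=> [|t ct]; [exact: PC_comp|exact: cont_points_comp].
Qed.

Lemma PC_Lagrangian : PC t0 t1 (fun s => L s (x s) (D s)).
Proof.
by case: C1L => U [_ GU h]; apply: (L_PC _).1 => t y v /GU/h[].
Qed.

Lemma PC_partial_x : PC t0 t1 Lx.
Proof.
by case: C1L => U [_ GU h]; apply: (L_PC _).1 => t y v /GU/h[].
Qed.

Lemma PC_partial_y : PC t0 t1 Ly.
Proof.
by case: C1L => U [_ GU h]; apply: (L_PC _).1 => t y v /GU/h[].
Qed.

Lemma cont_points_partial_y t : cont_points t0 t1 D t -> cont_points t0 t1 Ly t.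
Proof.
by case: C1L => U [_ GU h]; apply: (L_PC _).2 => u y v /GU/h[].
Qed.

(** The predicate [N] has a free third coordinate y, because near a discontinuity the local estimate
    is anchored at a one-sided limit which D itself need not attain. Membership in U is carried
    along to obtain continuity of L at the perturbed point, on which measurability of the perturbed
    integrand depends. *)
Lemma strict_differentiability_graph e : 0 < e -> exists2 d : R, 0 < d &
  forall s, cont_points t0 t1 D s -> forall u v u' v' : R,
    `|u| <= d -> `|v| <= d -> `|u'| <= d -> `|v'| <= d ->
    {for (s, x s + u, D s + v), continuous (uncurry3 L)} /\
    `|L s (x s + u) (D s + v) - L s (x s + u') (D s + v')
      - (Lx s * (u - u') + Ly s * (v - v'))| <= e * (`|u - u'| + `|v - v'|).
Proof.
case: C1L => U [openU GU h] e0.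
pose N (d s y : R) := forall u v u' v' : R,
    `|u| <= d -> `|v| <= d -> `|u'| <= d -> `|v'| <= d ->
    U (s, x s + u, y + v) /\
    `|L s (x s + u) (y + v) - L s (x s + u') (y + v')
      - (partial_x L s (x s) y * (u - u') + partial_y L s (x s) y * (v - v'))|
      <= e * (`|u - u'| + `|v - v'|).
have [|t v It lv|d d0 H] := @PC_uniform _ t0 t1 D N PCD.
- move=> d d' s y /andP[_ d'd] H u v u' v' h1 h2 h3 h4.
  by apply: H; exact: le_trans d'd.
- have [d d0 H] := strict_differentiability_local openU h
    (GU _ (limit_value_ext_graph lv)) e0.
  have /cont_pointsP[_ /(_ d d0)[d1 d10 h1]] := cx It.
  exists (Num.min d d1); first by rewrite lt_min d0.
  move=> s y; rewrite !lt_min => /andP[sd sd1] /andP[vd _] Is u v0 u' v0'.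
  rewrite !le_min => /andP[? _] /andP[? _] /andP[? _] /andP[? _].
  by apply: H => //; [rewrite distrC|exact: h1].
exists d => // s cs u v u' v' h1 h2 h3 h4.
have [/h[_ _ ? _ _] ?] := H s cs u v u' v' h1 h2 h3 h4.
by split.
Qed.

Lemma first_variation_integrable u v : PC t0 t1 u -> PC t0 t1 v ->
  mu.-integrable I01 (EFin \o (fun s => w s * (Lx s * u s + Ly s * v s))).
Proof.
move=> PCu PCv.
rewrite (_ : (fun s => _) = (fun s => w s * Lx s * u s + w s * Ly s * v s)); last first.
  by apply/funext => s; ring.
have i1 := integrableM_PC (integrableM_PC intw PC_partial_x) PCu.
have i2 := integrableM_PC (integrableM_PC intw PC_partial_y) PCv.
exact: (integrableDr (measurable_itv _) i1 i2).
Qed.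

Lemma first_variation_comb c d u v u' v' :
  PC t0 t1 u -> PC t0 t1 v -> PC t0 t1 u' -> PC t0 t1 v' ->
  first_variation (fun s => c * u s + d * u' s) (fun s => c * v s + d * v' s) =
  c * first_variation u v + d * first_variation u' v'.
Proof.
move=> PCu PCv PCu' PCv'.
have i1 := first_variation_integrable PCu PCv.
have i2 := first_variation_integrable PCu' PCv'.
rewrite /first_variation -!RintegralZl// -RintegralD//; last 2 first.
- exact: integrableZlr.
- exact: integrableZlr.
by apply: eq_Rintegral => s _; ring.
Qed.

(** Strict differentiability for the sup norms of u and v: the pointwise estimate integrated against
    the weight. Integrability is part of the conclusion, since the integrals can be subtracted under
    one sign only when each integrand is integrable. *)
Lemma perturbed_differentiable e : 0 < e -> exists2 d : R, 0 < d &
  forall u v, {within I01, continuous u} -> PC t0 t1 v ->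
    (forall s, t0 <= s <= t1 -> `|u s| <= d) ->
    (forall s, t0 <= s <= t1 -> `|v s| <= d) ->
  mu.-integrable I01 (EFin \o (fun s => w s * L s (x s + u s) (D s + v s))) /\
  forall u' v', {within I01, continuous u'} -> PC t0 t1 v' ->
    (forall s, t0 <= s <= t1 -> `|u' s| <= d) ->
    (forall s, t0 <= s <= t1 -> `|v' s| <= d) ->
  forall n : R, (forall s, t0 <= s <= t1 -> `|u s - u' s| <= n) ->
    (forall s, t0 <= s <= t1 -> `|v s - v' s| <= n) ->
  `|perturbed u v - perturbed u' v' -
    first_variation (fun s => u s - u' s) (fun s => v s - v' s)| <= e * n.
Proof.
move=> e0; pose W := \int[mu]_(s in I01) w s.
have W0 : 0 <= W by apply: Rintegral_ge0 => s _; exact: w_ge0.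
have W1 : 0 < W + 1 by rewrite ltr_wpDl.
(* The factor 2 accounts for the two increments, each at most n, and W is the total mass of the
   weight; adding 1 avoids a separate proof that W is nonzero. *)
have e'0 : 0 < e / (2 * (W + 1)) by rewrite divr_gt0// mulr_gt0.
set e' := e / _ in e'0.
have [d d0 H] := strict_differentiability_graph e'0.
pose A u := (I01 `\` cont_points t0 t1 D) `|` (I01 `\` cont_points t0 t1 u).
have finA u : PC t0 t1 u -> finite_set (A u).
  by case=> h _ _; rewrite finite_setU; split; [case: PCD|exact: h].
have nA u s : I01 s -> ~ A u s -> cont_points t0 t1 D s /\ cont_points t0 t1 u s.
  by move=> Is nAs; split; apply: contrapT => nc; apply: nAs; [left|right].
have mI : measurable I01 by exact: measurable_itv.
have [Mx Mx0 hMx] := PC_bounded PC_partial_x.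
have [My My0 hMy] := PC_bounded PC_partial_y.
have [ML ML0 hML] := PC_bounded PC_Lagrangian.
have integrable_perturbed u v : {within I01, continuous u} -> PC t0 t1 v ->
    (forall s, t0 <= s <= t1 -> `|u s| <= d) ->
    (forall s, t0 <= s <= t1 -> `|v s| <= d) ->
    mu.-integrable I01 (EFin \o (fun s => w s * L s (x s + u s) (D s + v s))).
  move=> cu PCv ud vd; pose g s := L s (x s + u s) (D s + v s).
  have fAv := finA _ PCv.
  have mg : measurable_fun I01 g.
    apply: measurable_finite_discontinuity; apply: sub_finite_set fAv => s [Is ncg].
    apply: contrapT => /(nA _ _ Is)[cD cv]; apply: ncg.
    have It : t0 <= s <= t1 by exact: cont_points_itv cD.
    apply: cont_points_uncurry3.
    - by apply: cont_pointsD; [exact: cx|move/within_continuousP : cu; exact].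
    - exact: cont_pointsD.
    - by have [] := H s cD (u s) (v s) (u s) (v s) (ud _ It) (vd _ It) (ud _ It) (vd _ It).
  have [M1 hM1] := finite_set_bounded g fAv.
  (* At continuity points L is bounded by its value on the graph, the linear part of the increment
     and the error. [M1] covers the finite exceptional set, where no estimate is available. *)
  pose M2 := ML + (Mx * d + My * d) + e' * (d + d).
  apply: (@integrable_dominated _ _ _ (fun s => Num.max M1 M2 * w s)) => //.
  - apply: measurable_funM => //; exact: measurable_powR_subr.
  - move=> s Is; rewrite normrM (ger0_norm (w_ge0 s)) mulrC ler_wpM2r// le_max.
    have [As|nAs] := pselect (A v s); first by rewrite hM1.
    apply/orP; right; have [cD cv] := nA _ _ Is nAs.
    have It : t0 <= s <= t1 by exact: cont_points_itv cD.
    have d0' : `|0 : R| <= d by rewrite normr0 ltW.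
    have [_] := H s cD (u s) (v s) 0 0 (ud _ It) (vd _ It) d0' d0'.
    rewrite !addr0 !subr0 -/(g s) => h.
    rewrite /M2 (_ : g s = L s (x s) (D s) + (Lx s * u s + Ly s * v s) +
       (g s - L s (x s) (D s) - (Lx s * u s + Ly s * v s))); last by ring.
    apply: le_trans (ler_normD _ _) _; apply: lerD; last first.
      apply: (le_trans h); apply: ler_wpM2l; first exact: ltW.
      by apply: lerD; [exact: ud|exact: vd].
    apply: le_trans (ler_normD _ _) _; apply: lerD; first exact: hML.
    apply: le_trans (ler_normD _ _) _; rewrite !normrM.
    apply: lerD; apply: ler_pM => //;
      [exact: hMx|exact: ud|exact: hMy|exact: vd].
  - by apply: integrableZlr.
exists d => // u v cu PCv ud vd; split; first exact: integrable_perturbed.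
move=> u' v' cu' PCv' u'd v'd n uu' vv'.
have i1 := integrable_perturbed _ _ cu PCv ud vd.
have i2 := integrable_perturbed _ _ cu' PCv' u'd v'd.
have PCB f g : PC t0 t1 f -> PC t0 t1 g -> PC t0 t1 (fun s => f s - g s).
  move=> PCf PCg; have := PC_comb 1 (-1) PCf PCg.
  by under [X in PC _ _ X -> _]eq_fun do rewrite mul1r mulN1r.
have i3 := first_variation_integrable (PCB _ _ (continuous_PC cu) (continuous_PC cu'))
  (PCB _ _ PCv PCv').
have i12 := integrableBr mI i1 i2; have i123 := integrableBr mI i12 i3.
rewrite /perturbed /first_variation -RintegralB// -RintegralB//.
have n0 : 0 <= n.
  by rewrite (le_trans _ (uu' t0 _))// lexx ltW.
apply: (@le_trans _ _ (\int[mu]_(s in I01) (e' * (n + n) * w s))).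
  apply: (le_norm_Rintegral_finite (finA _ (PCB _ _ PCv PCv'))) => //.
  - exact: integrableZlr.
  - by move=> s _; rewrite mulr_ge0// mulr_ge0 ?addr_ge0// ltW.
  - move=> s Is /(nA _ _ Is)[cD _].
    have It : t0 <= s <= t1 by exact: cont_points_itv cD.
    have [_ h] := H s cD _ _ _ _ (ud _ It) (vd _ It) (u'd _ It) (v'd _ It).
    rewrite -!mulrBr normrM (ger0_norm (w_ge0 s)) mulrC ler_wpM2r//.
    apply: (le_trans h); apply: ler_wpM2l; first exact: ltW.
    by apply: lerD; [exact: uu'|exact: vv'].
rewrite RintegralZl// -/W /e'.
rewrite (_ : _ * W = (e * n) * (W / (W + 1))); last by field; rewrite gt_eqF.
have en0 : 0 <= e * n by rewrite mulr_ge0// ltW.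
by apply: ler_piMr => //; rewrite ler_pdivrMr// mul1r lerDl.
Qed.
End functional.

End functional_estimate.

(** * The multiplier rule *)

Section two_parameter_multiplier.
Context {R : realType}.
Implicit Types (A B e d r s : R) (phi : R -> R -> R).

(** The strict form compares two arbitrary points near 0. With s = s' it yields continuity in r, as
    the intermediate value theorem requires; with s' = r' = 0 it is the usual first-order
    expansion. *)
Definition strictly_differentiable0 phi A B := forall e : R, 0 < e ->
  exists2 d : R, 0 < d & forall s r s' r',
    `|s| <= d -> `|r| <= d -> `|s'| <= d -> `|r'| <= d ->
    `|phi s r - phi s' r' - (A * (s - s') + B * (r - r'))| <=
      e * (`|s - s'| + `|r - r'|).

(* If [A0 != 0], moving [s] by [- sg A0 * d] lowers [phi0] to first order, and the
   intermediate value theorem restores the constraint with [`|r| <= k * d], where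
   [k] is so small that the effect of [r] on [phi0] is negligible. *)
Lemma two_parameter_multiplier phi0 phi1 A0 B0 B1 d0 :
  strictly_differentiable0 phi0 A0 B0 -> strictly_differentiable0 phi1 0 B1 ->
  B1 != 0 -> 0 < d0 ->
  (forall s r, `|s| <= d0 -> `|r| <= d0 -> phi1 s r = phi1 0 0 ->
    phi0 0 0 <= phi0 s r) ->
  A0 = 0.
Proof.
move=> D0 D1 B1_neq0 d00 min0; apply: contrapT => /eqP A0_neq0.
have A0_gt0 : 0 < `|A0| by rewrite normr_gt0.
have B1_gt0 : 0 < `|B1| by rewrite normr_gt0.
have B0_ge0 : 0 <= `|B0| by [].
pose k := Num.min 1 (`|A0| / (4 * (`|B0| + 1))).
have k0 : 0 < k by rewrite lt_min ltr01 divr_gt0// mulr_gt0// ltr_wpDl.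
have k1 : k <= 1 by rewrite ge_min lexx.
have kB0 : k * `|B0| <= `|A0| / 4.
  have : k <= `|A0| / (4 * (`|B0| + 1)) by rewrite ge_min lexx orbT.
  rewrite ler_pdivlMr ?mulr_gt0 ?ltr_wpDl// => h; nra.
(* Since |s| + |r| <= 2 d, the error in phi1 is at most half of |B1| k d, so phi1 - phi1(0, 0)
   changes sign between r = -k d and r = k d. The tolerance |A0| / 8 makes the error in phi0 at most
   |A0| d / 4; together with |B0 r| <= |A0| d / 4 this leaves a decrease of at least |A0| d / 2. *)
have e10 : 0 < k * `|B1| / 4 by rewrite divr_gt0// mulr_gt0.
have e00 : 0 < `|A0| / 8 by rewrite divr_gt0.
have [d1 d10 H1] := D1 _ e10; have [d2 d20 H0] := D0 _ e00.
pose d := Num.min d0 (Num.min d1 d2).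
have d_gt0 : 0 < d by rewrite !lt_min d00 d10.
have [dd0 dd1 dd2] : [/\ d <= d0, d <= d1 & d <= d2].
  by split; rewrite /d !ge_min lexx ?orbT.
pose s : R := - Num.sg A0 * d.
have sd : `|s| = d by rewrite normrM normrN normr_sg A0_neq0 mul1r gtr0_norm.
have As : A0 * s = - (`|A0| * d) by rewrite normrEsg /s; ring.
have kd : k * d <= d by rewrite ler_piMl// ltW.
have kd0 : 0 < k * d by rewrite mulr_gt0.
have rd r : - (k * d) <= r <= k * d -> `|r| <= d.
  by rewrite -ler_norml => /le_trans; apply.
pose f r := phi1 s r.
have fbound r : - (k * d) <= r <= k * d -> `|f r - phi1 0 0 - B1 * r| <= k * d * `|B1| / 2.
  move=> rkd; have n0 : `|0 : R| <= d1 by rewrite normr0 ltW.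
  have := H1 s r 0 0; rewrite sd (le_trans (rd _ rkd) dd1) => /(_ dd1 isT n0 n0).
  rewrite !subr0 mul0r add0r sd => /le_trans; apply.
  move: rkd; rewrite -ler_norml => rkd; nra.
have cf : {within `[- (k * d), k * d], continuous f}.
  apply/subspace_continuousP => r; rewrite /= in_itv/= => rkd.
  apply/cvg_withinP => e e0.
  have C0 : 0 < `|B1| + k * `|B1| / 4 + 1 by rewrite ltr_wpDl// addr_ge0// ltW.
  exists (e / (`|B1| + k * `|B1| / 4 + 1)); first by rewrite divr_gt0.
  move=> r' rr'; rewrite /= in_itv/= => r'kd.
  have := H1 s r s r'; rewrite sd (le_trans (rd _ rkd) dd1) (le_trans (rd _ r'kd) dd1).
  move=> /(_ dd1 isT dd1 isT); rewrite subrr normr0 mulr0 !add0r -/(f r) -/(f r') => h.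
  move: rr'; rewrite ltr_pdivlMr// distrC => rr'.
  have h2 : `|f r - f r'| <= `|f r - f r' - B1 * (r - r')| + `|B1| * `|r - r'|.
    by rewrite -normrM -[in leLHS](subrK (B1 * (r - r')) (f r - f r')) ler_normD.
  have := normr_ge0 (r - r'); nra.
have kdI : - (k * d) <= k * d by lra.
have [r rI fr] : exists2 r, r \in `[- (k * d), k * d] & f r = phi1 0 0.
  apply: IVT => //.
  have b1 : `|f (- (k * d)) - phi1 0 0 - B1 * - (k * d)| <= k * d * `|B1| / 2.
    by apply: fbound; rewrite lexx.
  have b2 : `|f (k * d) - phi1 0 0 - B1 * (k * d)| <= k * d * `|B1| / 2.
    by apply: fbound; rewrite lexx andbT.
  rewrite ge_min le_max.
  move: b1 b2; rewrite !ler_norml => /andP[? ?] /andP[? ?].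
  have [Bp|Bn|B0'] := ltgtP 0 B1; last by rewrite -B0' eqxx in B1_neq0.
    have E : `|B1| = B1 by rewrite gtr0_norm.
    by apply/andP; split; apply/orP; [left|right]; nra.
  have E : `|B1| = - B1 by rewrite ltr0_norm.
  by apply/andP; split; apply/orP; [right|left]; nra.
move: rI; rewrite in_itv/= => rkd.
have n0 : `|0 : R| <= d2 by rewrite normr0 ltW.
have := min0 s r; rewrite sd dd0 (le_trans (rd _ rkd) dd0) => /(_ isT isT fr) m.
have := H0 s r 0 0; rewrite sd (le_trans (rd _ rkd) dd2) => /(_ dd2 isT n0 n0).
rewrite !subr0 As sd => h.
have rB0 : `|B0 * r| <= d * `|A0| / 4.
  by rewrite normrM; move: rkd; rewrite -ler_norml => rkd; nra.
have rk : `|r| <= d by exact: rd.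
move: h rB0; rewrite !ler_norml => /andP[? ?] /andP[? ?]; nra.
Qed.
End two_parameter_multiplier.

(** * Variations u = I^alpha v and the functionals along them *)

Section variations.
Context {R : realType}.
Local Notation mu := (@lebesgue_measure R).
Implicit Types (A : set R) (c d e s t : R) (f g u v x : R -> R).

Variables t0 t1 a : R.
Hypotheses (t01 : t0 < t1) (a01 : 0 < a <= 1).
Local Notation I01 := (`[t0, t1]%classic : set R).

Let a0 : 0 < a. Proof. by case/andP: a01. Qed.

Definition fvariation u v : Prop :=
  [/\ {within I01, continuous u}, PC t0 t1 v &
      forall t, t0 <= t <= t1 -> u t = RL_left t0 a v t].

Lemma integrable_RL_kernel v t : PC t0 t1 v -> t0 <= t <= t1 ->
  mu.-integrable `[t0, t] (EFin \o (fun s => (t - s) `^ (a - 1) * v s)).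
Proof.
move=> PCv It; have [M M0 vM] := PC_bounded PCv; have /andP[t0t tt1] := It.
have sub := sub_itv_t0 It.
apply: (@integrable_dominated _ _ _ (fun s => M * (t - s) `^ (a - 1))) => //.
- apply: measurable_funM; first exact: measurable_powR_subr.
  by apply: measurable_funS (PC_measurable PCv).
- move=> s /sub; rewrite /= in_itv/= => Is.
  by rewrite normrM ger0_norm ?powR_ge0// mulrC ler_wpM2r ?powR_ge0// vM.
- by apply: integrableZlr => //; exact: integrable_powR_subr.
Qed.

Lemma RL_left_comb c d f g t : PC t0 t1 f -> PC t0 t1 g -> t0 <= t <= t1 ->
  RL_left t0 a (fun s => c * f s + d * g s) t =
  c * RL_left t0 a f t + d * RL_left t0 a g t.
Proof.
move=> PCf PCg It.
have i1 := integrable_RL_kernel PCf It; have i2 := integrable_RL_kernel PCg It.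
rewrite /RL_left !(mulrCA _ (Gamma a)^-1) -mulrDr; congr (_ * _).
rewrite -RintegralZl// -[X in _ = _ + X]RintegralZl// -RintegralD//.
- by apply: eq_Rintegral => s _; ring.
- exact: integrableZlr.
- exact: integrableZlr.
Qed.

Lemma RL_left_t0 f : RL_left t0 a f t0 = 0.
Proof. by rewrite /RL_left set_itv1 Rintegral_set1 mulr0. Qed.

Lemma within_continuous_comb c d u v : {within I01, continuous u} ->
  {within I01, continuous v} -> {within I01, continuous (fun s => c * u s + d * v s)}.
Proof.
move=> /within_continuousP cu /within_continuousP cv; apply/within_continuousP.
by move=> s Is; apply: cont_points_comb; [exact: cu|exact: cv].
Qed.

Lemma fvariation_comb c d u v u' v' : fvariation u v -> fvariation u' v' ->
  fvariation (fun s => c * u s + d * u' s) (fun s => c * v s + d * v' s).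
Proof.
move=> [cu PCv uv] [cu' PCv' u'v']; split.
- exact: within_continuous_comb.
- exact: PC_comb.
- by move=> t It; rewrite RL_left_comb// uv// u'v'.
Qed.

Lemma fvariation_t0 u v : fvariation u v -> u t0 = 0.
Proof. by case=> _ _ uv; rewrite uv ?lexx ?ltW// RL_left_t0. Qed.

Lemma fvariation_caputo u v t : fvariation u v -> cont_points t0 t1 v t ->
  caputo t0 t1 a u t = v t.
Proof.
move=> var; have [cu PCv uv] := var; apply: caputo_PCa => // s.
by rewrite (fvariation_t0 var) add0r => /uv.
Qed.

Lemma PCa_addition x u v : PCa t0 t1 a x -> fvariation u v ->
  PCa t0 t1 a (fun s => x s + u s) /\
  forall t, cont_points t0 t1 (caputo t0 t1 a x) t -> cont_points t0 t1 v t ->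
    caputo t0 t1 a (fun s => x s + u s) t = caputo t0 t1 a x t + v t.
Proof.
move=> PCx var; have [cu PCv uv] := var; have [cx _] := PCx.
have [PCD xE] := PCa_caputo t01 a01 PCx.
set D := caputo t0 t1 a x in PCD xE *.
have addE f g : (fun s => f s + g s) = (fun s => 1 * f s + 1 * g s) :> (R -> R).
  by apply/funext => s; rewrite !mul1r.
have PCDv : PC t0 t1 (fun s => D s + v s) by rewrite addE; exact: PC_comb.
have E t : t0 <= t <= t1 ->
    x t + u t = x t0 + u t0 + RL_left t0 a (fun s => D s + v s) t.
  move=> It; rewrite addE RL_left_comb// !mul1r (fvariation_t0 var) addr0.
  by rewrite xE// uv// addrA.
split.
  split; first by rewrite addE; exact: within_continuous_comb.
  by exists (fun s => D s + v s) => // t; rewrite in_itv; exact: E.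
move=> t cD cv; apply: (caputo_PCa t01 (psi := fun s => D s + v s)) => //.
exact: cont_pointsD.
Qed.

(** The essential supremum ignores the discontinuities of v, the only points of the segment where
    the Caputo derivative of u may differ from v. *)
Lemma PCa_norm_variation u v d : fvariation u v ->
  (forall s, t0 <= s <= t1 -> `|u s| <= d) ->
  (forall s, t0 <= s <= t1 -> `|v s| <= d) ->
  (PCa_norm t0 t1 a u <= (d + d)%:E)%E.
Proof.
move=> var ud vd; have [_ [finA _ _] _] := var.
have d0 : 0 <= d by apply: (le_trans _ (ud t0 _)); rewrite ?lexx ?(ltW t01).
rewrite /PCa_norm EFinD; apply: leeD.
  by apply: ub_ereal_sup => _ [t + <-]; rewrite /= in_itv/= => It; rewrite lee_fin ud.
rewrite unlock; case: ifPn => _ //.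
apply/ess_sup_inf.ess_supP.
exists (I01 `\` cont_points t0 t1 v); split.
- exact: finite_set_measurable.
- exact: finite_set_lebesgue0.
move=> s /= h; apply: contrapT => nA; apply: h; rewrite lee_fin patchE.
case: ifPn => [|_]; last by rewrite normr0.
rewrite inE/= => Is; have cv : cont_points t0 t1 v s.
  by apply: contrapT => nc; apply: nA; split.
by rewrite (fvariation_caputo var cv) vd// (cont_points_itv cv).
Qed.

Lemma functional_addition (b : R) (L : R -> R -> R -> R) x u v :
  PCa t0 t1 a x -> fvariation u v ->
  mu.-integrable I01 (EFin \o (fun s => (t1 - s) `^ (b - 1) *
    L s (x s + u s) (caputo t0 t1 a x s + v s))) ->
  functional t0 t1 a b L (fun s => x s + u s) = perturbed t0 t1 a b x L u v.
Proof.
move=> PCx var intL; have [PCxu cE] := PCa_addition PCx var.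
have [PCD _] := PCa_caputo t01 a01 PCx; have [finD _ _] := PCD.
have [_ [finv _ _] _] := var.
have finA : finite_set ((I01 `\` cont_points t0 t1 (caputo t0 t1 a x)) `|`
  (I01 `\` cont_points t0 t1 v)) by rewrite finite_setU.
apply: (Rintegral_finite _ finA) => //.
  by have /measurable_EFinP := measurable_int _ intL.
move=> s Is nA; rewrite cE//; apply: contrapT => nc; apply: nA; by [left|right].
Qed.

End variations.

(** * Step functions and their fractional integrals *)

Section step_variations.
Context {R : realType}.
Local Notation mu := (@lebesgue_measure R).
Implicit Types (A : set R) (c d e s t : R) (f g u v x : R -> R).

Variables t0 t1 a : R.
Hypotheses (t01 : t0 < t1) (a01 : 0 < a <= 1).
Local Notation I01 := (`[t0, t1]%classic : set R).

Let a0 : 0 < a. Proof. by case/andP: a01. Qed.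

Definition step c t : R := if c <= t then 1 else 0.
(** The fractional integral of [step c], with Gamma(a + 1) written as a Gamma(a), the form in which
    integrating the kernel produces it. *)
Definition step_integral c t : R := (Num.max (t - c) 0) `^ a / (a * Gamma a).

(** At t = c the function is not differentiable, so continuity there comes from the explicit radius
    e^(1/a). *)
Lemma cont_powR_max c t : t0 <= t <= t1 ->
  cont_points t0 t1 (fun s => (Num.max (s - c) 0) `^ a) t.
Proof.
move=> It; apply/cont_pointsP; split => // e e0.
have [tc|ct|ct] := ltgtP t c.
- exists (c - t); first by rewrite subr_gt0.
  move=> s; rewrite ltr_norml => /andP[_ sc] _.
  by rewrite !max_r ?subrr ?normr0//; lra.
- have /cvgrPdist_lt/(_ e e0)/near_nbhsP[d d0 h] := @continuous_powR_shift R c a t ct.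
  exists (Num.min d (t - c)); first by rewrite lt_min d0 subr_gt0.
  move=> s; rewrite lt_min => /andP[sd]; rewrite ltr_norml => /andP[cs _] _.
  by rewrite !max_l; [exact: h|lra|lra].
- exists (e `^ a^-1); first exact: powR_gt0.
  move=> s; rewrite ct subrr maxxx powR0 ?gt_eqF// sub0r normrN => sd _.
  rewrite ger0_norm ?powR_ge0//.
  have -> : e = (e `^ a^-1) `^ a by rewrite -powRrM mulVf ?gt_eqF// powRr1// ltW.
  apply: gt0_ltr_powR => //; rewrite ?nnegrE ?powR_ge0 ?le_max ?lexx ?orbT//.
  by rewrite gt_max powR_gt0// andbT (le_lt_trans _ sd)// ler_norm.
Qed.

Lemma PC_step c : t0 <= c < t1 -> PC t0 t1 (step c).
Proof.
move=> /andP[t0c ct1].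
have sub : I01 `\` cont_points t0 t1 (step c) `<=` [set c] `&` `]t0, t1[%classic.
  move=> s [/= ]; rewrite in_itv/= => Is ncs.
  have sc : s = c.
    apply: contrapT => /eqP sc; apply: ncs; apply/cont_pointsP; split => // e e0.
    have [slt|cs|e1] := ltgtP s c; last by rewrite e1 eqxx in sc.
      exists (c - s); first by rewrite subr_gt0.
      move=> r; rewrite ltr_norml => /andP[_ rc] _.
      by rewrite /step !leNgt slt (_ : r < c) ?subrr ?normr0//; lra.
    exists (s - c); first by rewrite subr_gt0.
    move=> r; rewrite ltr_norml => /andP[rc _] _.
    by rewrite /step (ltW cs) (_ : c <= r) ?subrr ?normr0//; lra.
  split => //=; rewrite in_itv/= sc ct1 andbT lt_neqAle t0c andbT.
  (* For c = t0 the step is constant on the segment, so t0 is never a discontinuity, as [PC]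
     requires. *)
  apply: contra_notT ncs; rewrite negbK => /eqP ct0; rewrite sc.
  apply/cont_pointsP; split => [|e e0]; first by rewrite t0c ltW.
  exists 1 => // r _ /andP[t0r _].
  by rewrite /step lexx -ct0 t0r subrr normr0.
split; first by apply: sub_finite_set (finite_set1 c) => s /sub[].
  by move=> s /sub[].
move=> t /sub[/= -> _]; split; apply/cvg_ex.
  exists 0; apply/cvg_withinP => e e0; exists 1 => // s _ sc.
  by rewrite /step leNgt sc subrr normr0.
exists 1; apply/cvg_withinP => e e0; exists 1 => // s _ sc.
by rewrite /step ltW// subrr normr0.
Qed.

Lemma fvariation_step c : t0 <= c < t1 ->
  fvariation t0 t1 a (step_integral c) (step c).
Proof.
move=> /[dup] Ic /andP[t0c ct1]; split; last 2 first.
- exact: PC_step.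
- move=> t /andP[t0t tt1]; rewrite /RL_left /step_integral.
  have [tc|ct] := ltP t c.
    rewrite max_r ?subr_le0 ?ltW// powR0 ?gt_eqF// mul0r.
    rewrite (_ : \int[mu]_(s in _) _ = \int[mu]_(s in `[t0, t]) (cst 0 s)).
      by rewrite Rintegral_cst//= mul0r mulr0.
    apply: eq_Rintegral => s; rewrite mem_setE in_itv/= => /andP[_ st].
    by rewrite /step leNgt (le_lt_trans st tc)/= mulr0.
  rewrite max_l ?subr_ge0//.
  rewrite (_ : \int[mu]_(s in _) _ = (t - c) `^ a / a).
    by rewrite invfM mulrA mulrC.
  have intE := integral_powR_subr ct a0.
  transitivity (\int[mu]_(s in `[c, t]) (t - s) `^ (a - 1)); last first.
    by rewrite /Rintegral intE.
  rewrite Rintegral_mkcond [RHS]Rintegral_mkcond; apply: eq_Rintegral => s _.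
  rewrite !patchE !mem_setE !in_itv/= /step.
  case: (leP c s) => [cs|sc] /=.
    have t0s := le_trans t0c cs; rewrite (_ : (t0 <= s <= t) = (s <= t)).
      by rewrite mulr1.
    by rewrite andb_idl.
  by rewrite mulr0; case: ifP.
apply/within_continuousP => t; rewrite /= in_itv/= => It.
have := cont_powR_max c It => -[? h]; split => //; exact: cvgMl.
Qed.

Lemma step_integral_t1 c : c <= t1 ->
  step_integral c t1 = (t1 - c) `^ a / (a * Gamma a).
Proof. by move=> ct; rewrite /step_integral max_l ?subr_ge0. Qed.

End step_variations.

(* [Q] is the terminal value of a variation; subtracting a multiple of the
   variation [i0] makes it vanish, so [G] only sees admissible directions. *)
Lemma multipliers_of_reduced_forms (R : realFieldType) (T : Type) (D : T -> Prop)
    (P0 P1 Q : T -> R) (i0 : T)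
    (G := fun (P : T -> R) i => P i - Q i / Q i0 * P i0) :
  Q i0 != 0 ->
  (forall i j r, D i -> D j -> G P1 j != 0 -> G P1 i = r * G P1 j ->
    G P0 i = r * G P0 j) ->
  exists m0 m1 : R, ~ (m0 = 0 /\ m1 = 0) /\
    exists k : R, forall i, D i -> m0 * P0 i + m1 * P1 i = k * Q i.
Proof.
move=> Q0 H; have [all0|] := pselect (forall i, D i -> G P1 i = 0).
  (* The abnormal case: the constraint is stationary in all reduced directions, and [P1] alone is a
     multiple of [Q]. *)
  exists 0, 1; split; first by case=> _ /eqP; rewrite oner_eq0.
  exists (P1 i0 / Q i0) => i Di; rewrite mul0r add0r mul1r.
  have /eqP := all0 i Di; rewrite subr_eq0 => /eqP ->; field.
  exact: Q0.
move=> /existsNP[j /not_implyP[Dj /eqP Gj]].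
(* The hypothesis makes [G P0] proportional to [G P1]; the ratio is read off at j. *)
pose q := G P0 j / G P1 j.
exists 1, (- q); split; first by case=> /eqP; rewrite oner_eq0.
exists ((P0 i0 - q * P1 i0) / Q i0) => i Di.
have E : G P0 i = q * G P1 i.
  rewrite (H i j (G P1 i / G P1 j) Di Dj Gj) /q; last by field.
  by field.
have -> : 1 * P0 i + - q * P1 i = G P0 i - q * G P1 i +
  (P0 i0 - q * P1 i0) / Q i0 * Q i by rewrite /G; field.
by rewrite E subrr add0r.
Qed.

(** * Lagrange multipliers at a weak local minimum *)

Section multipliers.
Context {R : realType}.
Local Notation mu := (@lebesgue_measure R).
Implicit Types (A : set R) (c d e s t r : R) (f g u v x : R -> R).

Variables (t0 t1 a b : R) (x : R -> R).
Hypotheses (t01 : t0 < t1) (a01 : 0 < a <= 1) (b0 : 0 < b).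
Hypothesis PCx : PCa t0 t1 a x.
Local Notation I01 := (`[t0, t1]%classic : set R).
Local Notation fvar := (fvariation t0 t1 a).

Let a0 : 0 < a. Proof. by case/andP: a01. Qed.

Lemma fvariation_bounded u v : fvar u v -> exists2 M : R, 0 < M &
  forall s, t0 <= s <= t1 -> `|u s| <= M /\ `|v s| <= M.
Proof.
move=> [cu PCv _]; have [M1 M10 h1] := PC_bounded (continuous_PC cu).
have [M2 M20 h2] := PC_bounded PCv.
exists (Num.max M1 M2); first by rewrite lt_max M10.
by move=> s Is; rewrite !le_max h1// h2// orbT.
Qed.

Section functional.
Variable L : R -> R -> R -> R.
Hypothesis C1L : C1xy_near L (ext_graph t0 t1 a x).

Lemma perturbed0 : perturbed t0 t1 a b x L (fun=> 0) (fun=> 0) = functional t0 t1 a b L x.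
Proof. by apply: eq_Rintegral => s _; rewrite !addr0. Qed.

(** The sup norm estimate is pulled back to two parameters: a change of (s, r) moves the variation
    by at most (|s - s'| + |r - r'|) M, whence the tolerance e / M and the radius d / M. *)
Lemma perturbed_strictly_differentiable u v u' v' : fvar u v -> fvar u' v' ->
  strictly_differentiable0
    (fun s r => perturbed t0 t1 a b x L (fun t => s * u t + r * u' t)
                                        (fun t => s * v t + r * v' t))
    (first_variation t0 t1 a b x L u v) (first_variation t0 t1 a b x L u' v').
Proof.
move=> var var' e e0.
have [cu PCv _] := var; have [cu' PCv' _] := var'.
have [M1 M10 h1] := fvariation_bounded var.
have [M2 M20 h2] := fvariation_bounded var'.
pose M := M1 + M2; have M0 : 0 < M by rewrite addr_gt0.
have e'0 : 0 < e / M by rewrite divr_gt0.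
have [d d0 H] := perturbed_differentiable t01 a01 b0 PCx C1L e'0.
have comb (p q k l m : R) : `|p| <= k -> `|q| <= k -> `|l| <= M1 -> `|m| <= M2 ->
    `|p * l + q * m| <= k * M.
  move=> pk qk lM mM; apply: le_trans (ler_normD _ _) _; rewrite !normrM mulrDr.
  by apply: lerD; exact: ler_pM.
exists (d / M) => [|s r s' r' sd rd s'd r'd]; first by rewrite divr_gt0.
have bu (p q : R) : `|p| <= d / M -> `|q| <= d / M -> forall t, t0 <= t <= t1 ->
    `|p * u t + q * u' t| <= d /\ `|p * v t + q * v' t| <= d.
  move=> pd qd t It; have [? ?] := h1 t It; have [? ?] := h2 t It.
  have dM : d / M * M = d by field; rewrite gt_eqF.
  by split; rewrite -dM; exact: comb.
have cc (p q : R) : {within I01, continuous (fun t => p * u t + q * u' t)}.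
  exact: within_continuous_comb.
have PCc (p q : R) : PC t0 t1 (fun t => p * v t + q * v' t) by exact: PC_comb.
have [||_ K] := H _ _ (cc s r) (PCc s r).
- by move=> t /(bu _ _ sd rd)[].
- by move=> t /(bu _ _ sd rd)[].
have := K _ _ (cc s' r') (PCc s' r') (fun t It => (bu _ _ s'd r'd t It).1)
  (fun t It => (bu _ _ s'd r'd t It).2) ((`|s - s'| + `|r - r'|) * M).
have dE f g t : s * f t + r * g t - (s' * f t + r' * g t) = (s - s') * f t + (r - r') * g t.
  by ring.
have dle t : t0 <= t <= t1 ->
    `|(s - s') * u t + (r - r') * u' t| <= (`|s - s'| + `|r - r'|) * M /\
    `|(s - s') * v t + (r - r') * v' t| <= (`|s - s'| + `|r - r'|) * M.
  move=> It; have [? ?] := h1 t It; have [? ?] := h2 t It.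
  by split; apply: comb => //; rewrite ?lerDl ?lerDr.
move=> {}K; have {K} := K _ _.
rewrite (_ : (fun t => s * u t + r * u' t - _) =
  (fun t => (s - s') * u t + (r - r') * u' t)); last by apply/funext => t.
rewrite (_ : (fun t => s * v t + r * v' t - _) =
  (fun t => (s - s') * v t + (r - r') * v' t)); last by apply/funext => t.
rewrite first_variation_comb//; [|exact: continuous_PC..].
rewrite !(mulrC (first_variation _ _ _ _ _ _ _ _)).
rewrite (_ : e / M * _ = e * (`|s - s'| + `|r - r'|)); last first.
  by field; rewrite gt_eqF.
by move=> {}K; apply: K => t It; rewrite dE; have [] := dle t It.
Qed.

Lemma functional_fvariation_near u v u' v' : fvar u v -> fvar u' v' ->
  exists2 d : R, 0 < d & forall s r, `|s| <= d -> `|r| <= d ->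
    functional t0 t1 a b L (fun t => x t + (s * u t + r * u' t)) =
    perturbed t0 t1 a b x L (fun t => s * u t + r * u' t)
                            (fun t => s * v t + r * v' t).
Proof.
move=> var var'.
have [M1 M10 h1] := fvariation_bounded var.
have [M2 M20 h2] := fvariation_bounded var'.
(* The tolerance 1 is arbitrary: only the integrability for small perturbations is extracted. *)
have [d d0 H] := perturbed_differentiable t01 a01 b0 PCx C1L ltr01.
pose M := M1 + M2; have M0 : 0 < M by rewrite addr_gt0.
exists (d / M) => [|s r sd rd]; first by rewrite divr_gt0.
have var2 : fvar (fun t => s * u t + r * u' t) (fun t => s * v t + r * v' t).
  exact: fvariation_comb.
have [cu PCv _] := var2.
apply: functional_addition => //.
have le (p q : R) : `|p| <= M1 -> `|q| <= M2 -> `|s * p + r * q| <= d.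
  move=> pM qM; have -> : d = d / M * M1 + d / M * M2.
    by rewrite -mulrDr -/M; field; rewrite gt_eqF.
  apply: le_trans (ler_normD _ _) _; rewrite !normrM.
  by apply: lerD; exact: ler_pM.
have [||//] := H _ _ cu PCv.
- by move=> t It; have [? ?] := h1 t It; have [? ?] := h2 t It; exact: le.
- by move=> t It; have [? ?] := h1 t It; have [? ?] := h2 t It; exact: le.
Qed.
End functional.

Section weak_local_minimum.
Variables (x0 x1 l1 : R) (L0 L1 : R -> R -> R -> R).
Hypothesis hmin : weak_local_min t0 t1 a b L0 L1 x0 x1 l1 x.
Hypotheses (hL0 : C1xy_near L0 (ext_graph t0 t1 a x))
  (hL1 : C1xy_near L1 (ext_graph t0 t1 a x)).
Local Notation J0 := (first_variation t0 t1 a b x L0).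
Local Notation J1 := (first_variation t0 t1 a b x L1).

Let lt_quarters d : 0 < d -> d / 4 + d / 4 < d.
Proof. by move=> d0; lra. Qed.

(** The pair (u, v) is the tested direction, tangent to the constraint; (u', v') is transversal and
    brings J_1 back to its prescribed value. Both vanish at t1, so every combination keeps the
    boundary values. *)
Lemma first_variation_eq0 u v u' v' : fvar u v -> fvar u' v' ->
  u t1 = 0 -> u' t1 = 0 -> J1 u v = 0 -> J1 u' v' != 0 -> J0 u v = 0.
Proof.
move=> var var' ut1 u't1 J1u J1u'.
have [[_ xt0 xt1 Jx] [d3 d30 m]] := hmin.
have [M1 M10 h1] := fvariation_bounded var.
have [M2 M20 h2] := fvariation_bounded var'.
pose M := M1 + M2; have M0 : 0 < M by rewrite addr_gt0.
have [d1 d10 H1] := functional_fvariation_near hL0 var var'.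
have [d2 d20 H2] := functional_fvariation_near hL1 var var'.
have s0 := perturbed_strictly_differentiable hL0 var var'.
have := perturbed_strictly_differentiable hL1 var var'; rewrite J1u => s1.
(* The bound d3 / (4 M) keeps both components of the combined variation below d3 / 4, so that the
   norm is at most d3 / 2. *)
pose d := Num.min (Num.min d1 d2) (d3 / (4 * M)).
have d0 : 0 < d by rewrite !lt_min d10 d20 divr_gt0// mulr_gt0.
apply: (two_parameter_multiplier s0 s1 J1u' d0) => s r sd rd /= E1.
have p0 L : perturbed t0 t1 a b x L (fun t => 0 * u t + 0 * u' t)
    (fun t => 0 * v t + 0 * v' t) = functional t0 t1 a b L x.
  by rewrite -perturbed0; apply: eq_Rintegral => t _; rewrite !mul0r !addr0.
have /andP[/andP[sd1 sd2] sd3] : (`|s| <= d1) && (`|s| <= d2) && (`|s| <= d3 / (4 * M)).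
  by rewrite -!le_min.
have /andP[/andP[rd1 rd2] rd3] : (`|r| <= d1) && (`|r| <= d2) && (`|r| <= d3 / (4 * M)).
  by rewrite -!le_min.
have J1E : functional t0 t1 a b L1 (fun t => x t + (s * u t + r * u' t)) = l1.
  by rewrite (H2 s r sd2 rd2) E1 p0.
have var2 : fvar (fun t => s * u t + r * u' t) (fun t => s * v t + r * v' t).
  exact: fvariation_comb.
have {}m : functional t0 t1 a b L0 x <=
    functional t0 t1 a b L0 (fun t => x t + (s * u t + r * u' t)); last first.
  by rewrite (H1 s r sd1 rd1) in m; apply: le_trans m; rewrite p0.
apply: m.
  split.
  - by have [] := PCa_addition t01 a01 PCx var2.
  - by rewrite (fvariation_t0 t01 var) (fvariation_t0 t01 var') !mulr0 !addr0.
  - by rewrite ut1 u't1 !mulr0 !addr0.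
  - exact: J1E.
rewrite (_ : _ \- _ = (fun t => s * u t + r * u' t)); last first.
  by apply/funext => t /=; rewrite addrC addKr.
have le (p q : R) : `|p| <= M1 -> `|q| <= M2 -> `|s * p + r * q| <= d3 / 4.
  move=> pM qM; have -> : d3 / 4 = d3 / (4 * M) * M1 + d3 / (4 * M) * M2.
    by rewrite -mulrDr -/M; field; rewrite gt_eqF.
  apply: le_trans (ler_normD _ _) _; rewrite !normrM.
  by apply: lerD; exact: ler_pM.
have d3lt : ((d3 / 4 + d3 / 4)%:E < d3%:E)%E by rewrite lte_fin; exact: lt_quarters.
apply: le_lt_trans d3lt.
apply: (PCa_norm_variation t01 a01 var2) => t It;
  by have [? ?] := h1 t It; have [? ?] := h2 t It; exact: le.
Qed.

(** The variation from t0 is the fixed one of [multipliers_of_reduced_forms], its terminal value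
    [Q t0] being positive. [gu c] and [gv c] form the step variation from c corrected to vanish at
    t1, and the reduced forms are the first variations along it. *)
Lemma integrated_multiplier_rule : exists m0 m1 : R, ~ (m0 = 0 /\ m1 = 0) /\
  exists k : R, forall c, t0 <= c < t1 ->
    m0 * J0 (step_integral a c) (step c) + m1 * J1 (step_integral a c) (step c) =
    k * ((t1 - c) `^ a / (a * Gamma a)).
Proof.
pose Q c := (t1 - c) `^ a / (a * Gamma a).
have Ga : 0 < Gamma a by exact: Gamma_gt0.
have Q0 : Q t0 != 0.
  by rewrite gt_eqF// divr_gt0// ?mulr_gt0// powR_gt0// subr_gt0.
have I0 : t0 <= t0 < t1 by rewrite lexx.
pose P L c := first_variation t0 t1 a b x L (step_integral a c) (step c).
pose gu c t := 1 * step_integral a c t + - (Q c / Q t0) * step_integral a t0 t.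
pose gv c t := 1 * step c t + - (Q c / Q t0) * step t0 t.
have var c : t0 <= c < t1 -> fvar (step_integral a c) (step c).
  exact: fvariation_step.
have varg c : t0 <= c < t1 -> fvar (gu c) (gv c).
  by move=> Ic; apply: fvariation_comb => //; exact: var.
have gt1 c : t0 <= c < t1 -> gu c t1 = 0.
  move=> /andP[_ ct1]; rewrite /gu (step_integral_t1 _ (ltW ct1)).
  rewrite (step_integral_t1 _ (ltW t01)) -/(Q c) -/(Q t0) mul1r mulNr.
  by rewrite -mulrA mulVf// mulr1 subrr.
have PCuv u v : fvar u v -> PC t0 t1 u /\ PC t0 t1 v.
  by case=> cu PCv _; split => //; exact: continuous_PC.
have Jg L c : C1xy_near L (ext_graph t0 t1 a x) -> t0 <= c < t1 ->
    first_variation t0 t1 a b x L (gu c) (gv c) = P L c - Q c / Q t0 * P L t0.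
  move=> hL Ic; have [p1 p2] := PCuv _ _ (var _ Ic).
  have [p3 p4] := PCuv _ _ (var _ I0).
  by rewrite (first_variation_comb t01 a01 b0 PCx hL 1 _ p1 p2 p3 p4) mul1r mulNr.
apply: (multipliers_of_reduced_forms (D := fun c => t0 <= c < t1) Q0).
move=> c d r Ic Id nz eqr.
have J1d : J1 (gu d) (gv d) != 0 by rewrite (Jg L1 d hL1 Id); exact: nz.
have J1c : J1 (gu c) (gv c) = r * J1 (gu d) (gv d).
  by rewrite (Jg L1 d hL1 Id) (Jg L1 c hL1 Ic); exact: eqr.
suff J0c : J0 (gu c) (gv c) = r * J0 (gu d) (gv d).
  by rewrite (Jg L0 d hL0 Id) (Jg L0 c hL0 Ic) in J0c.
have [p1 p2] := PCuv _ _ (varg _ Ic); have [p3 p4] := PCuv _ _ (varg _ Id).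
have combE L (hL : C1xy_near L (ext_graph t0 t1 a x)) :=
  first_variation_comb t01 a01 b0 PCx hL 1 (- r) p1 p2 p3 p4.
apply/eqP; rewrite -subr_eq0 -mulNr -[X in X + _]mul1r; apply/eqP.
rewrite -[LHS](combE L0 hL0).
(* The tested direction is the corrected variation at c minus r times that at d, on which J1
   vanishes by the choice of r; the one at d is transversal. *)
apply: (first_variation_eq0 _ (varg _ Id)) => //.
- by apply: fvariation_comb => //; exact: varg.
- by rewrite (gt1 c Ic) (gt1 d Id) !mulr0 addr0.
- exact: gt1.
- by rewrite [LHS](combE L1 hL1) J1c mul1r mulNr subrr.
Qed.

End weak_local_minimum.
End multipliers.

(** * The Euler equation *)

Section euler_equation.
Context {R : realType}.
Local Notation mu := (@lebesgue_measure R).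
Implicit Types (A : set R) (a c d e h s t y : R) (f g u v x : R -> R).

Lemma powR_ler (x1 x2 : R) a : 0 <= a -> 0 <= x1 -> x1 <= x2 -> x1 `^ a <= x2 `^ a.
Proof.
move=> a0 x10 x12; apply: ge0_ler_powR => //; rewrite nnegrE//.
exact: le_trans x12.
Qed.

(* [(y - e) `^ a >= (y - e) * y `^ (a - 1)], as [a <= 1]; this provides the
   dominating function for the difference quotients in [c]. *)
Lemma powR_diff_bound a y e : 0 < a <= 1 -> 0 < y -> 0 < e ->
  0 <= y `^ a - (Num.max (y - e) 0) `^ a <= e * y `^ (a - 1).
Proof.
move=> /andP[a0 a1] y0 e0; apply/andP; split.
  rewrite subr_ge0; apply: powR_ler; first exact: ltW.
    by rewrite le_max lexx orbT.
  by rewrite ge_max (ltW y0) andbT; lra.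
have ya : y * y `^ (a - 1) = y `^ a by rewrite mulr_powRB1// ltW.
have [ye|ey] := leP y e.
  rewrite max_r ?subr_le0// powR0 ?gt_eqF// subr0 -ya.
  by rewrite ler_wpM2r ?powR_ge0.
rewrite max_l ?subr_ge0 ?(ltW ey)//; have z0 : 0 < y - e by rewrite subr_gt0.
have <- : (y - e) * (y - e) `^ (a - 1) = (y - e) `^ a by rewrite mulr_powRB1// ltW.
have le1 : y `^ (a - 1) <= (y - e) `^ (a - 1).
  rewrite -(opprB 1 a) (powRN y) (powRN (y - e)) lef_pV2 ?posrE ?powR_gt0//.
  by apply: powR_ler; lra.
rewrite lerBlDr -lerBlDl -ya -mulrBl.
by apply: ler_wpM2l => //; exact: ltW.
Qed.

Lemma powR_quotient_cvg a y (e : nat -> R) : 0 < y -> (forall n, 0 < e n) ->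
  e @ \oo --> 0 ->
  (fun n => ((y `^ a - (y - e n) `^ a) / e n)) @ \oo --> a * y `^ (a - 1).
Proof.
move=> y0 e0 ecvg; have [ex dE] := is_derive1_powR a y0.
have /cvgrPdist_lt lim0 : (fun h : R => h^-1 *: ((h *: 1 + y) `^ a - y `^ a)) @ 0^' --> a * y `^ (a - 1).
  by rewrite -dE; exact: ex.
apply/cvgrPdist_lt => eps eps0.
have := lim0 _ eps0; rewrite near_withinE => /near_nbhsP[d d0 h].
have /cvgrPdist_lt/(_ d d0) := ecvg; apply: filterS => n.
rewrite /= sub0r normrN => end_.
have -> : (y `^ a - (y - e n) `^ a) / e n =
    (- e n)^-1 *: ((- e n *: 1 + y) `^ a - y `^ a).
  by rewrite /GRing.scale/= mulr1 (addrC (- e n)) invrN mulNr -mulrN opprB mulrC.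
by apply: h; rewrite ?subr0 ?normrN// oppr_eq0 gt_eqF.
Qed.

Lemma powR_small p e : 0 < p -> 0 < e -> exists2 d : R, 0 < d &
  forall h, 0 < h < d -> h `^ p < e.
Proof.
move=> p0 e0; exists (e `^ p^-1); first exact: powR_gt0.
move=> h /andP[h0 hd]; have -> : e = (e `^ p^-1) `^ p.
  by rewrite -powRrM mulVf ?gt_eqF// powRr1// ltW.
apply: gt0_ltr_powR => //; rewrite nnegrE; [exact: ltW|exact: powR_ge0].
Qed.

(** The form in which the limits at t1 are taken, h being the distance to t1: both powers tend to 0
    with h. *)
Lemma powR_vanishing K M N r s T : 0 < r -> 0 < s -> 0 < T -> 0 < M -> 0 < N ->
  (forall h, 0 < h < T -> K <= M * h `^ r + N * h `^ s) -> K <= 0.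
Proof.
move=> r0 s0 T0 M0 N0 hK; rewrite leNgt; apply/negP => K0.
have MK0 : 0 < K / (2 * M) by rewrite divr_gt0// mulr_gt0.
have NK0 : 0 < K / (2 * N) by rewrite divr_gt0// mulr_gt0.
have [d d0 hd] := powR_small r0 MK0; have [d' d'0 hd'] := powR_small s0 NK0.
pose h := Num.min T (Num.min d d') / 2.
have m0 : 0 < Num.min T (Num.min d d') by rewrite !lt_min T0 d0 d'0.
have h0 : 0 < h by rewrite divr_gt0.
have : h < Num.min T (Num.min d d') by rewrite /h ltr_pdivrMr// ltr_pMr// ltr1n.
rewrite !lt_min => /and3P[hT hhd hhd'].
have := hK h; rewrite h0 hT => /(_ isT).
apply/negP; rewrite -ltNge.
have l1 : M * h `^ r < K / 2.
  have -> : K / 2 = M * (K / (2 * M)) by field; rewrite gt_eqF.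
  by rewrite ltr_pM2l// hd// h0.
have l2 : N * h `^ s < K / 2.
  have -> : K / 2 = N * (K / (2 * N)) by field; rewrite gt_eqF.
  by rewrite ltr_pM2l// hd'// h0.
by rewrite [ltRHS](splitr K) ltrD.
Qed.

Lemma difference_quotient_sum (A1 A2 B1 B2 e k X Y g : R) :
  e != 0 -> g != 0 -> A1 + B1 = k * (X / g) -> A2 + B2 = k * (Y / g) ->
  e^-1 * (A1 - A2) + e^-1 * (B1 - B2) = k / g * ((X - Y) / e).
Proof.
move=> e0 g0 E1 E2; rewrite -mulrDr addrACA -opprD E1 E2.
by field; rewrite e0 g0.
Qed.

Variables (t0 t1 a b k : R) (p q : R -> R).
Hypotheses (t01 : t0 < t1) (a01 : 0 < a <= 1) (b0 : 0 < b).
Hypotheses (PCp : PC t0 t1 p) (PCq : PC t0 t1 q).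
Local Notation I01 := (`[t0, t1]%classic : set R).
Let w s := (t1 - s) `^ (b - 1).
Hypothesis H : forall c, t0 <= c < t1 ->
  \int[mu]_(s in I01) (w s * (p s * step_integral a c s + q s * step c s)) =
  k * ((t1 - c) `^ a / (a * Gamma a)).

Let a0 : 0 < a. Proof. by case/andP: a01. Qed.
Let Ga : 0 < Gamma a. Proof. exact: Gamma_gt0. Qed.
Let intw : mu.-integrable I01 (EFin \o w).
Proof. exact: integrable_powR_subr (ltW t01) b0. Qed.
Let intwp : mu.-integrable I01 (EFin \o (fun s => w s * p s)).
Proof. exact: integrableM_PC. Qed.
Let intwq : mu.-integrable I01 (EFin \o (fun s => w s * q s)).
Proof. exact: integrableM_PC. Qed.

Let PCstep c : t0 <= c < t1 -> PC t0 t1 (step_integral a c) /\ PC t0 t1 (step c).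
Proof.
by move=> /(fvariation_step a01)[cu PCv _]; split => //; exact: continuous_PC.
Qed.

Let sub_c c : t0 <= c -> (`[c, t1] : set R) `<=` I01.
Proof. by move=> t0c s; rewrite /= !in_itv/= => /andP[cs ->]; rewrite (le_trans t0c). Qed.

Lemma Rintegral_support f c : t0 <= c ->
  (forall s, t0 <= s < c -> f s = 0) ->
  \int[mu]_(s in I01) f s = \int[mu]_(s in `[c, t1]) f s.
Proof.
move=> t0c f0; rewrite Rintegral_mkcond [RHS]Rintegral_mkcond.
apply: eq_Rintegral => s _; rewrite !patchE !mem_setE !in_itv/=.
case: (leP c s) => [cs|sc]; first by rewrite (le_trans t0c cs).
by case: ifPn => // /andP[t0s _]; rewrite f0// t0s.
Qed.

Lemma step_integral0 c s : s <= c -> step_integral a c s = 0.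
Proof. by move=> sc; rewrite /step_integral max_r ?subr_le0// powR0 ?gt_eqF// mul0r. Qed.

(** The first integral runs over [[c, t1]] although its integrand vanishes up to d, so that the
    relations at c and at a later d share a domain and can be subtracted. *)
Lemma split_relation c d : t0 <= c -> c <= d -> d < t1 ->
  \int[mu]_(s in `[c, t1]) (w s * p s * step_integral a d s) +
  \int[mu]_(s in `[d, t1]) (w s * q s) = k * ((t1 - d) `^ a / (a * Gamma a)).
Proof.
move=> t0c cd dt1; have t0d := le_trans t0c cd.
have Id : t0 <= d < t1 by rewrite t0d.
have [PCu PCv] := PCstep Id.
have i1 := integrableM_PC intwp PCu; have i2 := integrableM_PC intwq PCv.
have mI : measurable I01 by exact: measurable_itv.
rewrite -H// -(@Rintegral_support (fun s => w s * p s * step_integral a d s) c t0c); last first.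
  move=> s /andP[_ sc]; rewrite step_integral0 ?mulr0//.
  exact: le_trans (ltW sc) cd.
have -> : \int[mu]_(s in `[d, t1]) (w s * q s) = \int[mu]_(s in I01) (w s * q s * step d s).
  rewrite (@Rintegral_support (fun s => w s * q s * step d s) d t0d); last first.
    by move=> s /andP[_ sd]; rewrite /step leNgt sd mulr0.
  apply: eq_Rintegral => s; rewrite mem_setE in_itv/= => /andP[ds _].
  by rewrite /step ds mulr1.
rewrite -RintegralD//; apply: eq_Rintegral => s _; ring.
Qed.

Lemma euler_equation_interior c : t0 <= c < t1 -> cont_points t0 t1 q c ->
  RL_right t1 a (fun s => w s * p s) c + w c * q c =
  k / Gamma a * (t1 - c) `^ (a - 1).
Proof.
move=> /andP[t0c ct1] cq; have tc0 : 0 < t1 - c by rewrite subr_gt0.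
pose e n : R := (t1 - c) / n.+2%:R.
have e0 n : 0 < e n by rewrite divr_gt0.
have ce n : c + e n < t1.
  by rewrite -ltrBrDl /e ltr_pdivrMr// ltr_pMr// ltr1n.
have ecvg : e @ \oo --> 0.
  rewrite -(mulr0 (t1 - c)); apply: cvgMr.
  have := @cvg_harmonic R; rewrite -(cvg_shiftS _) /=.
  exact.
have cce n : c <= c + e n by rewrite lerDl ltW.
have t0ce n : t0 <= c + e n by exact: le_trans (cce n).
have mc : measurable (`[c, t1]%classic : set R) by exact: measurable_itv.
have intS f : mu.-integrable I01 (EFin \o f) -> mu.-integrable `[c, t1] (EFin \o f).
  by move=> intf; apply: integrableS intf => //; exact: sub_c.
(* [A], [B] and [C] are the difference quotients between c and c + e n of the three terms of
   [split_relation]; their limits are the three terms of the Euler equation. *)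
pose K n s := (step_integral a c s - step_integral a (c + e n) s) / e n.
pose A n := \int[mu]_(s in `[c, t1]) (w s * p s * K n s).
pose B n := (e n)^-1 * \int[mu]_(s in `[c, c + e n]) (w s * q s).
pose C n := k / (a * Gamma a) * (((t1 - c) `^ a - (t1 - c - e n) `^ a) / e n).
have ABC n : A n + B n = C n.
  have intu d : t0 <= d < t1 -> mu.-integrable `[c, t1]
      (EFin \o (fun s => w s * p s * step_integral a d s)).
    by move=> /PCstep[PCu _]; apply: intS; exact: integrableM_PC.
  have r1 := split_relation t0c (lexx c) ct1.
  have r2 := split_relation t0c (cce n) (ce n).
  have r3 : \int[mu]_(s in `[c, t1]) (w s * q s) -
      \int[mu]_(s in `[c + e n, t1]) (w s * q s) =
      \int[mu]_(s in `[c, c + e n]) (w s * q s).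
    have i1 : mu.-integrable `]c + e n, t1] (EFin \o (fun s => w s * q s)).
      apply: integrableS (intS _ intwq) => // s; rewrite /= !in_itv/= => /andP[h ->].
      by rewrite andbT ltW// (le_lt_trans _ h).
    rewrite -(Rintegral_itv_obnd_cbnd i1) -(@Rintegral_itvB _ _ (BLeft c) _ (c + e n)).
    - by rewrite opprB addrCA subrr addr0.
    - exact: intS.
    - by rewrite bnd_simp.
    - by rewrite bnd_simp ltW.
  have A1 : A n = (e n)^-1 * (\int[mu]_(s in `[c, t1]) (w s * p s * step_integral a c s) -
      \int[mu]_(s in `[c, t1]) (w s * p s * step_integral a (c + e n) s)).
    have i1 : t0 <= c < t1 by rewrite t0c.
    have i2 : t0 <= c + e n < t1 by rewrite t0ce ce.
    rewrite -RintegralB//; [|exact: intu|exact: intu].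
    rewrite -RintegralZl//; last by apply: integrableBr => //; exact: intu.
    by apply: eq_Rintegral => s _; rewrite /K; field; rewrite gt_eqF.
  rewrite A1 /B /C -r3.
  rewrite -(addrA t1) -opprD.
  by apply: difference_quotient_sum; rewrite ?gt_eqF// mulr_gt0.
have Acvg : A @ \oo --> RL_right t1 a (fun s => w s * p s) c.
  have [M M0 hM] := PC_bounded PCp.
  pose f s := w s * p s * ((s - c) `^ (a - 1) / Gamma a).
  (* The bound of [powR_diff_bound] times that of p. Its possible singularities, at c and at t1,
     have exponents above -1, hence it is integrable. *)
  pose g s := M / (a * Gamma a) * ((s - c) `^ (a - 1) * w s).
  have mwp : measurable_fun (`[c, t1]%classic : set R) (fun s => w s * p s).
    by have /measurable_EFinP := measurable_int _ (intS _ intwp).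
  have mstep d : t0 <= d < t1 -> measurable_fun (`[c, t1]%classic : set R) (step_integral a d).
    move=> /PCstep[PCu _]; apply: measurable_funS (PC_measurable PCu) => //.
    exact: sub_c.
  have mK n : measurable_fun (`[c, t1]%classic : set R) (K n).
    apply: measurable_funM => //; apply: measurable_funB; apply: mstep.
      by rewrite t0c.
    by rewrite t0ce ce.
  have Kpos n s : c < s -> K n s = ((s - c) `^ a - (Num.max (s - c - e n) 0) `^ a) /
      (a * Gamma a) / e n.
    move=> cs; rewrite /K /step_integral (max_l (_ : 0 <= s - c)) ?subr_ge0 ?(ltW cs)//.
    by rewrite -mulrBl opprD addrA.
  have K0 n : K n c = 0 by rewrite /K !step_integral0// subrr mul0r.
  have Kcvg s : c < s -> K ^~ s @ \oo --> (s - c) `^ (a - 1) / Gamma a.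
    move=> cs; have sc0 : 0 < s - c by rewrite subr_gt0.
    have -> : (s - c) `^ (a - 1) / Gamma a =
        a * (s - c) `^ (a - 1) * (a * Gamma a)^-1 by field; rewrite !gt_eqF.
    have /cvgrPdist_lt lim1 : (fun n => (((s - c) `^ a - (s - c - e n) `^ a) / e n) *
        (a * Gamma a)^-1) @ \oo --> a * (s - c) `^ (a - 1) * (a * Gamma a)^-1.
      by apply: cvgMl; exact: powR_quotient_cvg.
    apply/cvgrPdist_lt => eps /lim1.
    have /cvgrPdist_lt/(_ _ sc0) := ecvg; apply: filterS2 => n.
    rewrite /= sub0r normrN gtr0_norm// => en; rewrite Kpos// max_l.
      by rewrite (mulrAC _ (e n)^-1).
    by rewrite subr_ge0 ltW.
  have fE : RL_right t1 a (fun s => w s * p s) c = \int[mu]_(s in `[c, t1]) f s.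
    rewrite /RL_right -RintegralZl//.
      by apply: eq_Rintegral => s _; rewrite /f; ring.
    apply: (@integrable_dominated _ _ _ (fun s => M * ((s - c) `^ (a - 1) * w s))) => //.
    - by apply: measurable_funM => //; exact: measurable_powR_subl.
    - move=> s Is; have := sub_c t0c Is; rewrite /= in_itv/= => It.
      rewrite normrM (ger0_norm (powR_ge0 _ _)) normrM (ger0_norm (powR_ge0 _ _)).
      rewrite mulrA mulrC; apply: ler_wpM2r; last exact: hM.
      by rewrite mulr_ge0 ?powR_ge0.
    - by apply: integrableZlr => //; exact: integrable_powR_subl_subr.
  have [|||||intf _ cvgI] := @dominated_convergence _ _ _ mu _ mc
    (fun n s => (w s * p s * K n s)%:E) (EFin \o f) (EFin \o g).
  - by move=> n; apply/measurable_EFinP; exact: (measurable_funM mwp (mK n)).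
  - apply/measurable_EFinP/measurable_funM => //; apply: measurable_funM => //.
    exact: measurable_powR_subl.
  (* The point c is excluded: [K n c] is 0 for all n, while for a = 1 the limit formula gives 0^0 =
     1 there. *)
  - exists [set c]; split => //; first exact: lebesgue_measure_set1.
    move=> s /= nc; apply: contrapT => sc; apply: nc; rewrite in_itv/= => /andP[cs st].
    have {cs} cs : c < s by rewrite lt_neqAle cs andbT eq_sym; exact/eqP.
    apply: cvg_EFin; first exact: nearW.
    rewrite /f; apply: cvgMr; exact: Kcvg.
  - by apply: integrableZlr => //; exact: integrable_powR_subl_subr.
  - apply: aeW => s n; rewrite /= in_itv/= => /andP[cs st].
    rewrite lee_fin; have Is : t0 <= s <= t1 by rewrite (le_trans t0c cs).
    rewrite normrM normrM (ger0_norm (powR_ge0 _ _ : 0 <= w s)).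
    have -> : g s = w s * M * ((s - c) `^ (a - 1) / (a * Gamma a)).
      by rewrite /g; ring.
    apply: ler_pM => //; first by rewrite mulr_ge0// powR_ge0.
      by apply: ler_wpM2l; [exact: powR_ge0|exact: hM].
    move: cs; rewrite le_eqVlt => /predU1P[<-|cs].
      by rewrite K0 normr0 divr_ge0 ?powR_ge0// mulr_ge0// ltW.
    rewrite Kpos//; have sc0 : 0 < s - c by rewrite subr_gt0.
    have /andP[l1 l2] := powR_diff_bound a01 sc0 (e0 n).
    rewrite ger0_norm; last by rewrite !divr_ge0// ltW// mulr_gt0.
    rewrite mulrAC; apply: ler_wpM2r; first by rewrite invr_ge0 ltW// mulr_gt0.
    by rewrite ler_pdivrMr// mulrC.
  rewrite fE; apply: fine_cvg; rewrite fineK; last exact: integrable_fin_num.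
  exact: cvgI.
have Bcvg : B @ \oo --> w c * q c.
  have cw : cont_points t0 t1 w c.
    apply/cont_pointsP; split; first by rewrite t0c ltW.
    move=> eps eps0; have := @continuous_powR_shift R 0 (b - 1) (t1 - c) tc0.
    move=> /cvgrPdist_lt/(_ eps eps0)/near_nbhsP[d d0 h].
    exists d => // s sc _; rewrite /w -(subr0 (t1 - c)) -(subr0 (t1 - s)).
    by apply: h; rewrite (_ : _ - _ = - (s - c)) ?normrN//; ring.
  have /cont_pointsP[_ cwq] : cont_points t0 t1 (fun s => w s * q s) c.
    by case: cw cq => [? ?] [_ ?]; split => //; exact: cvgM.
  apply/cvgrPdist_le => eps eps0; have [d d0 h] := cwq _ eps0.
  have /cvgrPdist_lt/(_ d d0) := ecvg; apply: filterS => n.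
  rewrite /= sub0r normrN gtr0_norm// => end_.
  have fce s : c <= s <= c + e n -> `|w s * q s - w c * q c| <= eps.
    move=> /andP[cs sce]; rewrite distrC ltW// h//.
      by rewrite ger0_norm ?subr_ge0//; lra.
    by rewrite (le_trans t0c cs)/= (le_trans sce)// ltW.
  have := Rintegral_average_bound intwq t0c (cce n) (ltW (ce n)) fce.
  rewrite addrAC subrr add0r => le1.
  rewrite /B distrC (_ : _ - _ = (e n)^-1 * (\int[mu]_(s in `[c, c + e n]) (w s * q s) -
    w c * q c * e n)); last by field; rewrite gt_eqF.
  by rewrite normrM gtr0_norm ?invr_gt0// mulrC ler_pdivrMr.
have Ccvg : C @ \oo --> k / Gamma a * (t1 - c) `^ (a - 1).
  have -> : k / Gamma a * (t1 - c) `^ (a - 1) =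
      k / (a * Gamma a) * (a * (t1 - c) `^ (a - 1)).
    by field; rewrite !gt_eqF.
  by apply: cvgMr; exact: powR_quotient_cvg.
have ABcvg : C @ \oo --> RL_right t1 a (fun s => w s * p s) c + w c * q c.
  by rewrite -(funext ABC); exact: cvgD.
exact: cvg_unique ABcvg Ccvg.
Qed.

Lemma weighted_average f c (v : R) e : t0 <= c < t1 ->
  mu.-integrable I01 (EFin \o (fun s => w s * f s)) ->
  (forall s, c <= s <= t1 -> `|f s - v| <= e) ->
  `|\int[mu]_(s in `[c, t1]) (w s * f s) - v * ((t1 - c) `^ b / b)| <=
  e * ((t1 - c) `^ b / b).
Proof.
move=> /andP[t0c ct1] intf fe.
have mc : measurable (`[c, t1]%classic : set R) by exact: measurable_itv.
have intS g : mu.-integrable I01 (EFin \o g) -> mu.-integrable `[c, t1] (EFin \o g).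
  by move=> intg; apply: integrableS intg => //; exact: sub_c.
have intfc := intS _ intf; have intwc := intS _ intw.
have -> : (t1 - c) `^ b / b = \int[mu]_(s in `[c, t1]) w s.
  by rewrite /Rintegral integral_powR_subr// ltW.
have intv (u : R) : mu.-integrable `[c, t1] (EFin \o (fun s => u * w s)).
  exact: integrableZlr.
have intD : mu.-integrable `[c, t1] (EFin \o (fun s => w s * f s - v * w s)).
  exact: integrableBr.
rewrite -!RintegralZl// -RintegralB//.
apply: (le_trans (le_normr_Rintegral _ intD)) => //.
apply: le_Rintegral => //.
- exact: integrable_norm.
- move=> s; rewrite /= in_itv/= => cs.
  rewrite (mulrC v) -mulrBr normrM ger0_norm ?powR_ge0// mulrC.
  by apply: ler_wpM2r; [exact: powR_ge0|exact: fe].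
Qed.

Lemma weighted_bound f c e : t0 <= c < t1 ->
  mu.-integrable I01 (EFin \o (fun s => w s * f s)) ->
  (forall s, c <= s <= t1 -> `|f s| <= e) ->
  `|\int[mu]_(s in `[c, t1]) (w s * f s)| <= e * ((t1 - c) `^ b / b).
Proof.
move=> Ic intf fe; have := @weighted_average f c 0 e Ic intf.
by rewrite mul0r subr0; apply => s /fe; rewrite subr0.
Qed.

Lemma tail_relation : exists2 M : R, 0 < M & forall c, t0 <= c < t1 ->
  `|\int[mu]_(s in `[c, t1]) (w s * q s) - k * ((t1 - c) `^ a / (a * Gamma a))| <=
  M * ((t1 - c) `^ a * (t1 - c) `^ b).
Proof.
have [M M0 hM] := PC_bounded PCp.
have aG0 : 0 < a * Gamma a by rewrite mulr_gt0.
exists (M / (a * Gamma a) / b); first by rewrite !divr_gt0.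
move=> c /[dup] Ic /andP[t0c ct1]; have [PCu _] := PCstep Ic.
rewrite -(split_relation t0c (lexx c) ct1) opprD addrCA subrr addr0 normrN.
under eq_Rintegral do rewrite -mulrA.
apply: le_trans (@weighted_bound (fun s => p s * step_integral a c s) c
  (M * ((t1 - c) `^ a / (a * Gamma a))) Ic _ _) _.
- rewrite (_ : (fun s => _) = (fun s => w s * p s * step_integral a c s)); last first.
    by apply/funext => s; rewrite mulrA.
  exact: integrableM_PC.
- move=> s /andP[cs st1]; rewrite normrM; apply: ler_pM => //.
    by apply: hM; rewrite (le_trans t0c cs).
  rewrite /step_integral max_l ?subr_ge0// ger0_norm ?divr_ge0 ?powR_ge0 ?(ltW aG0)//.
  apply: ler_wpM2r; first by rewrite invr_ge0 ltW.
  by apply: powR_ler; [exact: ltW|rewrite subr_ge0|rewrite lerB].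
- by rewrite le_eqVlt; apply/orP; left; apply/eqP; ring.
Qed.

(** With h = t1 - c, dividing [tail_relation] by h^a bounds |k| / (a Gamma(a)) by (N / b) h^(b - a)
    + M h^b, where N bounds q; both exponents are positive. *)
Lemma multiplier_eq0 : a < b -> k = 0.
Proof.
move=> ab; have [M M0 hM] := tail_relation; have [N N0 hN] := PC_bounded PCq.
have aG0 : 0 < a * Gamma a by rewrite mulr_gt0.
have : `|k| / (a * Gamma a) <= 0.
  apply: (@powR_vanishing _ (N / b) M (b - a) b (t1 - t0)) => //.
  - by rewrite subr_gt0.
  - by rewrite subr_gt0.
  - by rewrite divr_gt0.
  move=> h /andP[h0 ht]; have Ic : t0 <= t1 - h < t1 by apply/andP; split; lra.
  have := hM _ Ic; have := @weighted_bound q _ N Ic intwq.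
  rewrite subKr; set X := Rintegral _ _ _ => l1 l2.
  have {}l1 : `|X| <= N * (h `^ b / b).
    apply: l1 => s /andP[cs st1]; apply: hN; rewrite st1 andbT.
    by apply: le_trans cs; case/andP: Ic.
  have ha : 0 < h `^ a by exact: powR_gt0.
  rewrite -(ler_pM2l ha) mulrDr !(mulrCA (h `^ a)).
  have -> : h `^ a * h `^ (b - a) = h `^ b.
    by rewrite -powRD ?(gt_eqF h0) ?implybT// addrC subrK.
  have -> : `|k| * (h `^ a / (a * Gamma a)) = `|k * (h `^ a / (a * Gamma a))|.
    by rewrite normrM (gtr0_norm (divr_gt0 ha aG0)).
  have -> : N / b * h `^ b + M * (h `^ a * h `^ b) =
      M * (h `^ a * h `^ b) + N * (h `^ b / b) by rewrite addrC; congr (_ + _); ring.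
  apply: le_trans (lerD l2 l1); rewrite distrC.
  by rewrite -[in leLHS](subrK X (k * _)) ler_normD.
by rewrite pmulr_lle0 ?invr_gt0// normr_le0 => /eqP.
Qed.

(** Dividing [tail_relation] by h^b / b compares q(t1) with k b / (a Gamma(a)) h^(a - b). For a = b
    this is k / Gamma(a), and 0^0 = 1; for b < a it tends to 0, and so the right side is 0. The
    convention for powers of 0 makes one formula of the two cases. *)
Lemma euler_equation_endpoint : b <= a -> cont_points t0 t1 q t1 ->
  q t1 = k / Gamma a * 0 `^ (a - b).
Proof.
move=> ba /cont_pointsP[_ cq]; have [M M0 hM] := tail_relation.
have aG0 : 0 < a * Gamma a by rewrite mulr_gt0.
have est e : 0 < e -> exists2 d : R, 0 < d & forall h, 0 < h < d ->
    `|q t1 - k * (b / (a * Gamma a)) * h `^ (a - b)| <= e + M * b * h `^ a.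
  move=> e0; have [d d0 hd] := cq _ e0.
  exists (Num.min d (t1 - t0)); first by rewrite lt_min d0 subr_gt0.
  move=> h; rewrite lt_min => /and3P[h0 hhd ht].
  have Ic : t0 <= t1 - h < t1 by apply/andP; split; lra.
  have := hM _ Ic; have := @weighted_average q _ (q t1) e Ic intwq.
  rewrite subKr; set X := Rintegral _ _ _ => l1 l2.
  have {}l1 : `|X - q t1 * (h `^ b / b)| <= e * (h `^ b / b).
    apply: l1 => s /andP[cs st1]; rewrite distrC ltW// hd//.
      by rewrite distrC ger0_norm ?subr_ge0//; lra.
    by rewrite st1 andbT; apply: le_trans cs; case/andP: Ic.
  have hb : 0 < h `^ b by exact: powR_gt0.
  have hbb : 0 < h `^ b / b by rewrite divr_gt0.
  rewrite -(ler_pM2l hbb) -[X in X * _ <= _](gtr0_norm hbb) -normrM.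
  have -> : h `^ b / b * (q t1 - k * (b / (a * Gamma a)) * h `^ (a - b)) =
      q t1 * (h `^ b / b) - k * (h `^ a / (a * Gamma a)).
    have -> : h `^ a = h `^ b * h `^ (a - b).
      by rewrite -powRD ?(gt_eqF h0) ?implybT// addrC subrK.
    by move: (h `^ b) (h `^ (a - b)) (q t1) => y z v; field; rewrite !gt_eqF.
  have -> : h `^ b / b * (e + M * b * h `^ a) =
      e * (h `^ b / b) + M * (h `^ a * h `^ b).
    by move: (h `^ a) (h `^ b) => y z; field; rewrite gt_eqF.
  apply: le_trans (lerD l1 l2).
  by rewrite (distrC X (q t1 * _)); exact: ler_distD.
(* The slack e comes from continuity of q at t1; it stays fixed while h tends to 0 and is arbitrary
   in the end. *)
apply/eqP; rewrite -subr_eq0 -normr_le0; apply/ler_addgt0Pr => e e0; rewrite add0r -subr_le0.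
have [d d0 hd] := est _ e0.
move: ba; rewrite le_eqVlt => /predU1P[ab|ba].
  rewrite ab subrr powRr0 mulr1.
  (* One vanishing term is enough here; the second, 1 times h^a, only fits the shape of
     [powR_vanishing]. *)
  apply: (@powR_vanishing _ (M * b) 1 a a d) => //; first by rewrite mulr_gt0.
  move=> h h0; have := hd _ h0; rewrite ab subrr powRr0 mulr1.
  have -> : k * (a / (a * Gamma a)) = k / Gamma a by field; rewrite !gt_eqF.
  by rewrite mul1r -lerBlDl => /le_trans; apply; rewrite lerDl powR_ge0.
rewrite powR0 ?mulr0 ?subr0; last by rewrite subr_eq0 gt_eqF.
pose N := `|k * (b / (a * Gamma a))| + 1.
have N0 : 0 < N by rewrite ltr_wpDl.
apply: (@powR_vanishing _ (M * b) N a (a - b) d) => //.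
- by rewrite subr_gt0.
- by rewrite mulr_gt0.
move=> h h0; have := hd _ h0; set K := k * _.
move=> l; rewrite lerBlDl addrA; apply: le_trans (lerD l (_ : `|K * h `^ (a - b)| <= _)).
  by rewrite -[in leLHS](subrK (K * h `^ (a - b)) (q t1)) ler_normD.
rewrite normrM (ger0_norm (powR_ge0 _ _)); apply: ler_wpM2r; first exact: powR_ge0.
by rewrite lerDl.
Qed.

End euler_equation.

(** * The combined Lagrangian and the equations at all continuity points *)

Section combination.
Context {R : realType}.
Local Notation mu := (@lebesgue_measure R).

Lemma derive1_comb (f g : R -> R) (c d x : R) : derivable f x 1 -> derivable g x 1 ->
  derive1 (fun u => c * f u + d * g u) x = c * derive1 f x + d * derive1 g x.
Proof.
move=> df dg; rewrite !derive1E.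
have dcf : derivable (c \*: f) x 1 by exact: derivableZ.
have ddg : derivable (d \*: g) x 1 by exact: derivableZ.
have fE : 'D_1 (c \*: f) x = c * 'D_1 f x by exact: deriveZ.
have gE : 'D_1 (d \*: g) x = d * 'D_1 g x by exact: deriveZ.
by rewrite -fE -gE; exact: deriveD.
Qed.

Lemma weighted_comb (m0 m1 w p p' q q' u v : R) :
  w * ((m0 * p + m1 * p') * u + (m0 * q + m1 * q') * v) =
  m0 * (w * (p * u + q * v)) + m1 * (w * (p' * u + q' * v)).
Proof. ring. Qed.

Variables (t0 t1 a : R) (x : R -> R) (L0 L1 : R -> R -> R -> R).
Hypotheses (C1L0 : C1xy_near L0 (ext_graph t0 t1 a x))
           (C1L1 : C1xy_near L1 (ext_graph t0 t1 a x)).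
Let D := caputo t0 t1 a x.

(** Linearity of the partial derivatives needs both Lagrangians to be differentiable at the point.
    This is known on the extended graph, hence at continuity points of D, and not at the unspecified
    values of D. *)
Lemma partial_comb (c d t : R) : cont_points t0 t1 D t ->
  let L := fun t x y => c * L0 t x y + d * L1 t x y in
  partial_x L t (x t) (D t) =
    c * partial_x L0 t (x t) (D t) + d * partial_x L1 t (x t) (D t) /\
  partial_y L t (x t) (D t) =
    c * partial_y L0 t (x t) (D t) + d * partial_y L1 t (x t) (D t).
Proof.
move=> ct L; have Gt : ext_graph t0 t1 a x (t, x t, D t) by left; exists t.
have [U0 [_ /(_ _ Gt) U0t h0]] := C1L0; have [U1 [_ /(_ _ Gt) U1t h1]] := C1L1.
have [x0 y0 _ _ _] := h0 _ _ _ U0t; have [x1 y1 _ _ _] := h1 _ _ _ U1t.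
rewrite /partial_x /partial_y /L; split.
  by rewrite (derive1_comb c d x0 x1).
by rewrite (derive1_comb c d y0 y1).
Qed.

End combination.

Theorem theorem2 (R : realType) (t0 t1 alpha beta x0 x1 l1 : R)
    (L0 L1 : R -> R -> R -> R) (xhat : R -> R)
    (ht : t0 < t1) (halpha : 0 < alpha <= 1) (hbeta : 0 < beta)
    (hmin : weak_local_min t0 t1 alpha beta L0 L1 x0 x1 l1 xhat)
    (hL0 : C1xy_near L0 (ext_graph t0 t1 alpha xhat))
    (hL1 : C1xy_near L1 (ext_graph t0 t1 alpha xhat)) :
  exists mu0 mu1 : R, ~ (mu0 = 0 /\ mu1 = 0) /\
    let D := caputo t0 t1 alpha xhat in
    let T := cont_points t0 t1 D in
    let L := fun t x y => mu0 * L0 t x y + mu1 * L1 t x y in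
    let b := fun t =>
      (t1 - t) `^ (beta - 1) * partial_x L t (xhat t) (D t) in
    (alpha < beta ->
      forall t, T t ->
        (t1 - t) `^ (1 - alpha) * RL_right t1 alpha b t
        + (t1 - t) `^ (beta - alpha) * partial_y L t (xhat t) (D t) = 0) /\
    (beta <= alpha ->
      exists k : R, forall t, T t ->
        (t1 - t) `^ (1 - beta) * RL_right t1 alpha b t
        + partial_y L t (xhat t) (D t)
        = k / Gamma alpha * (t1 - t) `^ (alpha - beta)).
Proof.
have [[PCx _ _ _] _] := hmin.
have [m0 [m1 [mN0 [k rule]]]] := integrated_multiplier_rule ht halpha hbeta PCx hmin hL0 hL1.
exists m0, m1; split => // D T L b.
have PCD : PC t0 t1 D by have [] := PCa_caputo ht halpha PCx.
pose Lx M s := partial_x M s (xhat s) (D s); pose Ly M s := partial_y M s (xhat s) (D s).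
(* Combinations of the separate partial derivatives, rather than the partial derivatives of L, since
   only the former are known to be piecewise continuous; the two agree on T. *)
pose p s := m0 * Lx L0 s + m1 * Lx L1 s; pose q s := m0 * Ly L0 s + m1 * Ly L1 s.
pose w s := (t1 - s) `^ (beta - 1).
have PCp : PC t0 t1 p by apply: PC_comb; apply: PC_partial_x.
have PCq : PC t0 t1 q by apply: PC_comb; apply: PC_partial_y.
have cq t : T t -> cont_points t0 t1 q t.
  by move=> Tt; apply: cont_points_comb; exact: cont_points_partial_y.
have H c : t0 <= c < t1 ->
    \int[lebesgue_measure]_(s in `[t0, t1]) (w s * (p s * step_integral alpha c s + q s * step c s)) =
    k * ((t1 - c) `^ alpha / (alpha * Gamma alpha)).
  move=> Ic; rewrite -(rule _ Ic).
  have [cu PCv _] := fvariation_step halpha Ic; have PCu := continuous_PC cu.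
  have i0 := first_variation_integrable ht halpha hbeta PCx hL0 PCu PCv.
  have i1 := first_variation_integrable ht halpha hbeta PCx hL1 PCu PCv.
  rewrite /first_variation -!RintegralZl// -RintegralD//; last 2 first.
  - exact: integrableZlr.
  - exact: integrableZlr.
  by apply: eq_Rintegral => s _; exact: weighted_comb.
have pE t : T t -> Lx L t = p t by move=> Tt; have [] := partial_comb hL0 hL1 m0 m1 Tt.
have qE t : T t -> Ly L t = q t by move=> Tt; have [] := partial_comb hL0 hL1 m0 m1 Tt.
have [finT _ _] := PCD.
(* The points of the segment outside T are finitely many, so the integral does not see where p and
   L_x may differ. *)
have RLE t : t0 <= t -> RL_right t1 alpha b t = RL_right t1 alpha (fun s => w s * p s) t.
  move=> t0t; rewrite /RL_right; congr (_ * _).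
  apply: Rintegral_finite finT _ _ => //.
  - apply: measurable_funM; first exact: measurable_powR_subl.
    apply: measurable_funM; first exact: measurable_powR_subr.
    apply: measurable_funS (PC_measurable PCp) => // s; rewrite /= !in_itv/= => /andP[ts ->].
    by rewrite (le_trans t0t).
  - move=> s Is nT; congr (_ * (_ * _)); apply: pE; apply: contrapT => Ts; apply: nT; split => //.
    by move: Is; rewrite /= !in_itv/= => /andP[ts ->]; rewrite (le_trans t0t).
have interior t : T t -> t < t1 -> RL_right t1 alpha b t + w t * Ly L t =
    k / Gamma alpha * (t1 - t) `^ (alpha - 1).
  move=> Tt tt1; have /andP[t0t _] := cont_points_itv Tt.
  have It : t0 <= t < t1 by rewrite t0t.
  rewrite RLE// qE//.
  exact: (euler_equation_interior ht halpha hbeta PCp PCq H It (cq _ Tt)).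
have RL1 : RL_right t1 alpha b t1 = 0.
  by rewrite /RL_right set_itv1 Rintegral_set1 mulr0.
have powM t (r s : R) : t < t1 -> (t1 - t) `^ r * (t1 - t) `^ s = (t1 - t) `^ (r + s).
  by move=> tt1; rewrite powRD// subr_eq0 (gt_eqF tt1) implybT.
have endpoints t : T t -> t = t1 \/ t < t1.
  move=> /cont_points_itv/andP[_]; rewrite le_eqVlt => /predU1P[|]; by [left|right].
split=> [ab|ba].
  have k0 := multiplier_eq0 ht halpha hbeta PCp PCq H ab.
  move=> t Tt; have [->|tt1] := endpoints _ Tt.
    (* At t1 both terms vanish: the fractional integral is over a single point, and 0 is raised to
       the positive power beta - alpha. *)
    by rewrite RL1 mulr0 add0r subrr powR0 ?mul0r// subr_eq0 gt_eqF.
  have -> : (t1 - t) `^ (beta - alpha) * partial_y L t (xhat t) (D t) =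
      (t1 - t) `^ (1 - alpha) * (w t * Ly L t).
    by rewrite mulrA powM//; congr (_ `^ _ * _); ring.
  by rewrite -mulrDr (interior _ Tt tt1) k0 !mul0r mulr0.
exists k => t Tt; have [tE|tt1] := endpoints _ Tt.
  (* At t1 the fractional integral is 0, whatever the power in front of it, and the claim becomes
     the endpoint value of L_y. *)
  rewrite tE RL1 mulr0 add0r subrr; rewrite tE in Tt.
  rewrite -/(Ly L t1) qE//.
  exact: (euler_equation_endpoint ht halpha hbeta PCp PCq H ba (cq _ Tt)).
have w1 : (t1 - t) `^ (1 - beta) * w t = 1.
  by rewrite powM// addrC subrKA subrr powRr0.
have -> : partial_y L t (xhat t) (D t) = (t1 - t) `^ (1 - beta) * (w t * Ly L t).
  by rewrite mulrA w1 mul1r.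
rewrite -mulrDr (interior _ Tt tt1) mulrCA powM//; congr (_ * _ `^ _); ring.
Qed.
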